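(* Let $0<\alpha\le 1$, $2<\beta\le 3$, $\gamma\in\mathbb{R}$, and let $f:[0,1]\times\mathbb{R}\times\mathbb{R}\to\mathbb{R}$ be a continuous function such that: (i) there exists a constant $w>0$ with $$|f(t,x,y)-f(t,u,v)|\le w\left(|x-u|+|y-v|\right)\qquad\text{for all } t\in[0,1],\ x,y,u,v\in\mathbb{R};$$ (ii) there exist a nonnegative function $\sigma\in L[0,1]$, constants $a_1,a_2\in\mathbb{R}_+$ and exponents $0<\tau_1,\tau_2<1$ with $$|f(t,x,y)|\le \sigma(t)+a_1|x|^{\tau_1}+a_2|y|^{\tau_2}\qquad\text{for all } t\in[0,1],\ x,y\in\mathbb{R}.$$ Put $$\psi_1=\frac{14w}{\Gamma(\alpha+\beta+1)}+\frac{8|\gamma|}{\Gamma(\alpha+1)},\qquad \psi_2=\frac{36w}{\Gamma(\alpha+\beta+1)}+\frac{18|\gamma|}{\Gamma(\alpha+1)},\qquad \psi=\psi_1+\psi_2.$$ If $\psi<1$, then the boundary value problem $${}^{c}D_{0+}^{\beta}\left({}^{c}D_{0+}^{\alpha}+\gamma\right)x(t)=f(t,x(t),x'(t)),\qquad t\in(0,1),$$ $$x(0)=x(1)=x'(0)=x'(1)=0,$$ has a unique solution.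
   Context: For $\rho>0$, the Caputo fractional derivative of order $\rho$ of a function $g$ is $${}^{c}D_{0+}^{\rho}g(\omega)=\frac{1}{\Gamma(m-\rho)}\int_0^{\omega}(\omega-s)^{m-\rho-1}g^{(m)}(s)\,ds,\qquad m=[\rho]+1,$$ when $\rho$ is not an integer, and ${}^{c}D_{0+}^{\rho}g=g^{(\rho)}$ (ordinary derivative) when $\rho$ is a positive integer. $L[0,1]$ is the space of Lebesgue integrable functions on $[0,1]$. Solutions are sought in the Banach space $B=C^1[0,1]$ with norm $\|x\|=\max_{t\in[0,1]}|x(t)|+\max_{t\in[0,1]}|x'(t)|$: a solution is a function $x\in C^1[0,1]$ for which the equation holds on $(0,1)$ and the boundary conditions hold.
   Formalization: For non-integer order the Caputo derivative is taken as d/dt of the order m-ρ integral of g^(m-1)-g^(m-1)(0), equal to the stated formula when g^(m) is integrable; with the stated formula existence can fail, since f is only continuous in t and the third derivative need not exist. *)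

(* Defs.v *)
From HB Require Import structures.
From mathcomp Require Import all_boot all_order all_algebra.
From mathcomp Require Import all_classical all_reals all_analysis.

Set Implicit Arguments.
Unset Strict Implicit.
Unset Printing Implicit Defensive.

Import Order.TTheory GRing.Theory Num.Theory.
Import numFieldNormedType.Exports.

Local Open Scope classical_set_scope.
Local Open Scope ring_scope.

Section Caputo.
Context {R : realType}.
Implicit Types (g x : R -> R) (a rho t : R).

Definition Gamma a : R :=
  \int[lebesgue_measure]_(s in `[0, +oo[) (s `^ (a - 1) * expR (- s)).

(* Differentiation of functions on [0, 1]: two-sided at interior points,
   one-sided at 0 and at 1. *)
Definition quot01 g t : R -> R := fun s => (g s - g t) / (s - t).

Definition derivable01 g t : Prop :=
  cvg (quot01 g t s @[s --> within `[0, 1] t^']).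

Definition deriv01 g t : R := lim (quot01 g t s @[s --> within `[0, 1] t^']).

Definition derivn01 (n : nat) g : R -> R := iter n deriv01 g.

(* Continuous differentiability of order n on a subinterval A of [0, 1]. *)
Definition Cn (A : set R) (n : nat) g : Prop :=
  forall k, (k <= n)%N ->
    {within A, continuous (derivn01 k g)} /\
    ((k < n)%N -> forall t, A t -> derivable01 (derivn01 k g) t).

Definition RLint a g t : R :=
  (Gamma a)^-1 *
  \int[lebesgue_measure]_(s in `[0, t]) ((t - s) `^ (a - 1) * g s).

Definition caputo_primitive rho g : R -> R :=
  let n := Num.truncn rho in
  RLint (n.+1%:R - rho) (fun s => derivn01 n g s - derivn01 n g 0).

Definition caputo rho g t : R :=
  if rho \is a Num.nat then derivn01 (Num.truncn rho) g t
  else deriv01 (caputo_primitive rho g) t.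

Definition caputo_derivable rho g : Prop :=
  if rho \is a Num.nat then
    forall k, (k < Num.truncn rho)%N ->
      forall t, t \in `]0, 1[ -> derivable01 (derivn01 k g) t
  else
    Cn `[0, 1[ (Num.truncn rho) g /\
    forall t, t \in `]0, 1[ -> derivable01 (caputo_primitive rho g) t.

Definition langevin alpha gamma x : R -> R :=
  fun t => caputo alpha x t + gamma * x t.

Definition is_solution alpha beta gamma (f : R -> R -> R -> R) x : Prop :=
  [/\ Cn `[0, 1] 1 x,
      caputo_derivable alpha x /\ caputo_derivable beta (langevin alpha gamma x),
      forall t, t \in `]0, 1[ ->
        caputo beta (langevin alpha gamma x) t = f t (x t) (deriv01 x t) &
      [/\ x 0 = 0, x 1 = 0, deriv01 x 0 = 0 & deriv01 x 1 = 0]].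

End Caputo.

(* Main.v *)
From HB Require Import structures.
Require Import Defs.
From mathcomp Require Import all_boot all_order all_algebra.
From mathcomp Require Import all_classical all_reals all_analysis.
From mathcomp Require Import measurable_realfun ring lra.

(** Write I^a for the Riemann-Liouville integral RLint a.  Everything rests on
the semigroup law I^a I^b = I^(a+b), obtained from Tonelli's theorem for the
kernels t^(a-1) on the half-line; their convolution is a multiple of t^(a+b-1),
and integrating against exp(-t) identifies the multiple as
Gamma(a)Gamma(b)/Gamma(a+b).  Since I^1 inverts differentiation, the semigroup law
inverts both Caputo derivatives, and the boundary value problem becomes the
fixed-point equation
  x = I^(alpha+beta) f(., x, x') - gamma I^alpha x
      + d1 t^(alpha+1) + d2 t^(alpha+2),
where x'(0) = 0 has removed the term t^alpha and d1, d2 are determined by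
x(1) = x'(1) = 0.  Passing from (x, x') to the right-hand side and its derivative
changes the sup norms (N0, N1) of a difference into at most
(psi1 (N0 + N1), psi2 (N0 + N1)), so it contracts by the factor psi in the sup norm
weighted by (psi1, psi2); existence follows by Picard iteration. *)

Set Implicit Arguments.
Unset Strict Implicit.
Unset Printing Implicit Defensive.

Import Order.TTheory GRing.Theory Num.Theory.
Import numFieldNormedType.Exports.

Local Open Scope classical_set_scope.
Local Open Scope ring_scope.

(** * Convolution of nonnegative functions on the line *)

Section Convolution.
Context {R : realType}.
Local Notation mu := (@lebesgue_measure R).
Local Open Scope ereal_scope.

(** For noninteger order, [caputo] differentiates a fractional integral of g^(n) - g^(n)(0), and
    [caputo_derivable] controls g^(n) on [[0, 1[] only. So a solution brings no integrable third
    derivative of h = [langevin alpha gamma x], and h'' may a priori be unbounded near 1. The order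
    beta is therefore inverted on intervals [0, T] with T < 1, and the formula reaches t = 1 because
    h itself is continuous on [0, 1]: as x is C^1, its derivative of order alpha is I^(1-alpha) x',
    or x' itself when alpha = 1.

    Tonelli's theorem asks for nonnegative functions, while f(., x, x') has no sign. Each identity
    is first proved for g >= 0; a continuous g follows by adding a constant bound M and subtracting
    the identity for the constant.

    The iteration acts on pairs (x, u) with x = I^1 u rather than on x alone. This relation alone
    turns the derivative of I^alpha x into I^alpha u, even though alpha - 1 is no longer a positive
    order, and it survives uniform limits. *)

Lemma lebesgue_measure_affine (c r : R) (A : set R) : (0 < c)%R ->
  measurable A ->
  c%:E * mu ((fun x : R => c * x + r)%R @^-1` A) = mu A.
Proof.
move=> c0 mA.
have mphi : measurable_fun setT (fun x : R => (c * x + r)%R : measurableTypeR R).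
  by apply: measurable_funD => //; exact: measurable_funM.
pose phi : R -> measurableTypeR R := (fun x : R => (c * x + r)%R).
pose k : {nonneg R} := NngNum (ltW c0).
pose nu : {measure set (measurableTypeR R) -> \bar R} :=
  mscale k (pushforward mu phi).
suff H : forall X, ocitv X -> mu X = nu mphi X.
  exact/esym/(lebesgue_measure_unique H).
move=> _ [[a b]] _ <-; rewrite /nu /mscale /pushforward.
rewrite [X in _ = _ * mu X](_ : _ =
    `]((a - r) / c)%R, ((b - r) / c)%R]%classic); last first.
  apply/seteqP; split => x /=; rewrite !in_itv/= ltr_pdivrMr// ler_pdivlMr//;
  by rewrite ltrBlDr lerBrDr (mulrC x).
rewrite !lebesgue_measure_itv/= !lte_fin ltr_pM2r ?invr_gt0// ltrD2r.
case: ifP => _; last by rewrite mule0.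
rewrite -!EFinB -EFinM; congr EFin; field.
by rewrite gt_eqF.
Qed.

(** Used with c = 1 for translations and with r = 0 to rescale the power kernels. *)
Lemma ge0_integral_affine (c r : R) (f : R -> \bar R) : (0 < c)%R ->
  measurable_fun setT f -> (forall x, 0 <= f x) ->
  \int[mu]_x f x = c%:E * \int[mu]_x f (c * x + r)%R.
Proof.
move=> c0 mf f0.
have mphi : measurable_fun setT (fun x : R => (c * x + r)%R : measurableTypeR R).
  by apply: measurable_funD => //; exact: measurable_funM.
pose phi : R -> measurableTypeR R := (fun x : R => (c * x + r)%R).
pose k : {nonneg R} := NngNum (ltW c0).
pose nu : {measure set (measurableTypeR R) -> \bar R} := pushforward mu phi.
transitivity (\int[mscale k (nu mphi)]_x f x).
  apply: eq_measure_integral => A mA _.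
  exact/esym/lebesgue_measure_affine.
rewrite ge0_integral_mscale//=.
by rewrite ge0_integral_pushforward.
Qed.

Lemma ge0_integral_shift (r : R) (f : R -> \bar R) :
  measurable_fun setT f -> (forall x, 0 <= f x) ->
  \int[mu]_x f (x - r)%R = \int[mu]_x f x.
Proof.
move=> mf f0; rewrite (@ge0_integral_affine 1 (- r) f)// mul1e.
by apply: eq_integral => x _; rewrite mul1r.
Qed.

(** Extended values let Tonelli's theorem apply before any integral is known to be finite. *)
Definition convol (f g : R -> \bar R) (t : R) : \bar R :=
  \int[mu]_s (f (t - s)%R * g s).

Lemma measurable_sub2 (f : R -> \bar R) : measurable_fun setT f ->
  measurable_fun setT (fun p : R * R => f (p.1 - p.2)%R).
Proof.
move=> mf; apply: measurableT_comp => //.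
by apply: measurable_funB; [exact: measurable_fst|exact: measurable_snd].
Qed.

Lemma measurable_convol_kernel (f g : R -> \bar R) :
  measurable_fun setT f -> measurable_fun setT g ->
  measurable_fun setT (fun p : R * R => f (p.1 - p.2)%R * g p.2).
Proof.
move=> mf mg; apply: emeasurable_funM; first exact: measurable_sub2.
by apply: measurableT_comp => //; exact: measurable_snd.
Qed.

Lemma measurable_shift (f : R -> \bar R) (r : R) : measurable_fun setT f ->
  measurable_fun setT (fun s : R => f (s - r)%R).
Proof.
move=> mf; apply: measurableT_comp => //.
exact: measurable_funB.
Qed.

Lemma measurable_rshift (f : R -> \bar R) (r : R) : measurable_fun setT f ->
  measurable_fun setT (fun s : R => f (r - s)%R).
Proof.
move=> mf; apply: measurableT_comp => //.
exact: measurable_funB.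
Qed.

Lemma convol_ge0 (f g : R -> \bar R) t :
  (forall x, 0 <= f x) -> (forall x, 0 <= g x) -> 0 <= convol f g t.
Proof. by move=> f0 g0; apply: integral_ge0 => s _; rewrite mule_ge0. Qed.

(** After exchanging the integrals, the inner one is over a translate of f and does not depend on
    s. *)
Lemma integral_convol (f g : R -> \bar R) :
  measurable_fun setT f -> measurable_fun setT g ->
  (forall x, 0 <= f x) -> (forall x, 0 <= g x) ->
  \int[mu]_t convol f g t = \int[mu]_t f t * \int[mu]_t g t.
Proof.
move=> mf mg f0 g0.
rewrite /convol (@fubini_tonelli _ _ _ _ R mu mu (fun p : R * R => f (p.1 - p.2)%R * g p.2)); last 2 first.
- exact: measurable_convol_kernel.
- by move=> p; rewrite mule_ge0.
rewrite -ge0_integralZl//; last by apply: integral_ge0.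
apply: eq_integral => s _ /=.
rewrite ge0_integralZr//; first by rewrite ge0_integral_shift.
exact: measurable_shift.
Qed.

Lemma convolA (f g h : R -> \bar R) t :
  measurable_fun setT f -> measurable_fun setT g -> measurable_fun setT h ->
  (forall x, 0 <= f x) -> (forall x, 0 <= g x) -> (forall x, 0 <= h x) ->
  convol f (convol g h) t = convol (convol f g) h t.
Proof.
move=> mf mg mh f0 g0 h0.
transitivity (\int[mu]_s \int[mu]_r (f (t - s)%R * (g (s - r)%R * h r))).
  apply: eq_integral => s _; rewrite /convol -ge0_integralZl//.
    apply: emeasurable_funM => //; exact: measurable_rshift.
  by move=> r _; rewrite mule_ge0.
rewrite (@fubini_tonelli _ _ _ _ R mu mu
  (fun p : R * R => f (t - p.1)%R * (g (p.1 - p.2)%R * h p.2))); last 2 first.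
- apply: emeasurable_funM; last exact: measurable_convol_kernel.
  apply: (measurableT_comp (measurable_rshift t mf)); exact: measurable_fst.
- by move=> p; rewrite !mule_ge0.
apply: eq_integral => r _ /=.
under eq_integral do rewrite muleA.
rewrite ge0_integralZr//; last 2 first.
- apply: emeasurable_funM; [exact: measurable_rshift|exact: measurable_shift].
- by move=> s _; rewrite mule_ge0.
congr (_ * _); rewrite /convol.
(* The translation s -> s - r recentres the inner integral as a convolution at t - r. *)
rewrite -(@ge0_integral_shift r (fun s => f (t - r - s)%R * g s)); last 2 first.
- by apply: emeasurable_funM => //; exact: measurable_rshift.
- by move=> s; rewrite mule_ge0.
by apply: eq_integral => s _; congr (f _ * _); ring.
Qed.

End Convolution.

(** * The kernels of fractional integration and the Gamma function *)

Section Kernel.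
Context {R : realType}.
Local Notation mu := (@lebesgue_measure R).
Implicit Types (a b t : R).

(* The value 0 at t = 0 makes the scaling law and the convolution formula below
   hold for every t; [RLint] itself sees 0 `^ (a - 1) at the endpoint s = t, a null
   set. *)
Definition pker a t : R := if 0 < t then t `^ (a - 1) else 0.

Lemma pker_ge0 a t : 0 <= pker a t.
Proof. by rewrite /pker; case: ifP => // _; exact: powR_ge0. Qed.

Lemma pker_le0 a t : t <= 0 -> pker a t = 0.
Proof. by rewrite /pker ltNge => ->. Qed.

Lemma pker_gt0 a t : 0 < t -> pker a t = t `^ (a - 1).
Proof. by rewrite /pker => ->. Qed.

Lemma measurable_pker a : measurable_fun setT (pker a).
Proof.
apply: measurable_fun_ifT => //; first exact: measurable_fun_ltr.
Qed.

Lemma measurable_EFin_pker a : measurable_fun setT (EFin \o pker a).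
Proof. by apply/measurable_EFinP; exact: measurable_pker. Qed.

(** The integrand of [Gamma a], extended by 0 to the whole line so that it can be convolved. *)
Definition epker a t : R := pker a t * expR (- t).

Lemma epker_ge0 a t : 0 <= epker a t.
Proof. by rewrite mulr_ge0 ?pker_ge0 ?expR_ge0. Qed.

Lemma measurable_epker a : measurable_fun setT (epker a).
Proof.
apply: measurable_funM; first exact: measurable_pker.
by apply: measurableT_comp => //; exact: measurable_funN.
Qed.

Lemma measurable_EFin_epker a : measurable_fun setT (EFin \o epker a).
Proof. by apply/measurable_EFinP; exact: measurable_epker. Qed.

(** The integrand may be singular at 0, so []0, 1]] is exhausted by the intervals [1/(n+1), 1], on
    which the fundamental theorem applies. The upper bound suffices for the finiteness of
    [Gamma]. *)
Lemma integral_powR_01_le a : 0 < a ->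
  (\int[mu]_(s in `]0%R, 1%R]) (s `^ (a - 1))%:E <= (a^-1)%:E)%E.
Proof.
move=> a0.
pose F (i : nat) := `[(i.+1%:R^-1 : R), 1]%classic.
have F01 : \bigcup_i F i = `]0, 1]%classic.
  apply/seteqP; split => [x [i _]|x]; rewrite /F /= !in_itv/= => /andP[x0 x1].
    by rewrite x1 andbT (lt_le_trans _ x0)// invr_gt0.
  exists (Num.truncn x^-1) => //=; rewrite in_itv/= x1 andbT.
  rewrite invf_ple ?posrE//; apply/ltW/truncnS_gt.
have cF : (\int[mu]_(s in F i) (s `^ (a - 1))%:E @[i --> \oo] -->
    \int[mu]_(s in \bigcup_i F i) (s `^ (a - 1))%:E)%E.
  apply: ge0_nondecreasing_set_cvg_integral => //.
  - apply/nondecreasing_seqP => n; rewrite subsetEset; apply: subset_itvr.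
    by rewrite bnd_simp lef_pV2 ?posrE// ler_nat.
  - by move=> i; exact: measurable_itv.
  - move=> i; apply/measurable_EFinP; apply: measurable_funTS.
    exact: measurable_powR.
  - by move=> i x _; rewrite lee_fin powR_ge0.
rewrite -F01; have <- := cvg_lim (@ereal_hausdorff R) cF.
apply: lime_le; first by apply/cvg_ex; eexists; exact: cF.
near=> i.
have i0 : 0 < (i.+1%:R^-1 : R) by rewrite invr_gt0.
have i1 : (i.+1%:R^-1 : R) < 1.
  by rewrite invf_lt1// ltr1n ltnS; near: i; exact: nbhs_infty_gt.
have dF (x : R) : 0 < x ->
    is_derive x 1 (fun s => a^-1 * s `^ a) (x `^ (a - 1)).
  move=> x0; have := is_deriveZ a^-1 (is_derive1_powR a x0).
  by rewrite scalerA mulVf ?gt_eqF// scale1r.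
have cG (x : R) : 0 < x -> {for x, continuous (fun s => a^-1 * s `^ a)}.
  move=> /dF[dx _].
  by apply: differentiable_continuous; exact/derivable1_diffP.
rewrite (@continuous_FTC2 _ _ (fun s => a^-1 * s `^ a))//.
- rewrite -EFinB lee_fin powR1 mulr1 lerBlDr lerDl.
  by rewrite mulr_ge0 ?powR_ge0 ?invr_ge0 ?ltW.
- apply: derivable_within_continuous => x; rewrite in_itv/= => /andP[ix _].
  by apply: derivable_powR; rewrite in_itv/= andbT (lt_le_trans i0).
- split.
  + move=> x; rewrite in_itv/= => /andP[ix _].
    by have [] := dF x (lt_trans i0 ix).
  + apply: cvg_at_right_filter.
    exact: cG.
  + apply: cvg_at_left_filter.
    exact: cG.
- move=> x; rewrite in_itv/= => /andP[ix _].
  by rewrite derive1E; have [_ ->] := dF x (lt_trans i0 ix).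
Unshelve. all: by end_near. Qed.

(** Raise y <= exp y, at y = s / (2a), to the power a. *)
Lemma powR_le_expR a s : 0 < a -> 0 <= s ->
  s `^ a <= (2 * a) `^ a * expR (s / 2).
Proof.
move=> a0 s0.
have h : s <= (2 * a) * expR (s / (2 * a)).
  rewrite -ler_pdivrMl ?mulr_gt0// mulrC.
  by apply: le_trans (expR_ge1Dx _); rewrite lerDr.
apply: (@le_trans _ _ (((2 * a) * expR (s / (2 * a))) `^ a)).
  rewrite ge0_ler_powR ?nnegrE ?(ltW a0)//.
  by rewrite mulr_ge0 ?expR_ge0// mulr_ge0 ?ltW.
rewrite powRM ?expR_ge0//; last by rewrite mulr_ge0 ?ltW.
rewrite ler_wpM2l ?powR_ge0//.
rewrite [X in X `^ a]lock /powR -lock gt_eqF ?expR_gt0// expRK ler_expR.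
by rewrite le_eqVlt; apply/orP; left; apply/eqP; field; rewrite gt_eqF.
Qed.

Lemma integral_epker_lty a : 0 < a -> (\int[mu]_x (epker a x)%:E < +oo)%E.
Proof.
move=> a0.
(* Beyond 1 the integrand is dominated by C times the exponential density of rate 1/2: the factor
   (2a)^a comes from [powR_le_expR], and the 2 cancels the rate in front of the density. *)
pose C := 2 * (2 * a) `^ a.
have C0 : 0 <= C by rewrite mulr_ge0 ?powR_ge0.
pose h1 := (fun s : R => s `^ (a - 1)) \_ `]0, 1].
have mh1 : measurable_fun setT h1.
  by apply/(measurable_restrictT _ _).1 => //; apply: measurable_funTS.
have h10 x : 0 <= h1 x by rewrite /h1 patchE; case: ifP => // _; exact: powR_ge0.
have e0 x : 0 <= exponential_pdf (2^-1 : R) x by apply: exponential_pdf_ge0; rewrite invr_ge0.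
apply: (@le_lt_trans _ _
    (\int[mu]_x ((h1 x)%:E + (C%:E * (exponential_pdf 2^-1 x)%:E)))%E).
  apply: ge0_le_integral => //.
  - by move=> x _; rewrite lee_fin epker_ge0.
  - exact: measurable_EFin_epker.
  - apply: emeasurable_funD; first exact/measurable_EFinP.
    apply: emeasurable_funM => //.
    by apply/measurable_EFinP; exact: measurable_exponential_pdf.
  - move=> x _; rewrite -EFinM -EFinD lee_fin /epker /pker.
    have [x0|x0] := ltP 0 x; last by rewrite mul0r addr_ge0// mulr_ge0.
    rewrite /h1 patchE mem_setE in_itv/= x0/=.
    have [x1|x1] := leP x 1.
      apply: ler_wpDr; first exact: mulr_ge0.
      rewrite ler_piMr ?powR_ge0//.
      by rewrite -expR0 ler_expR oppr_le0 ltW.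
    rewrite add0r exponential_pdfE; last exact: ltW.
    apply: (@le_trans _ _ (x `^ a * expR (- x))).
      by rewrite ler_wpM2r ?expR_ge0// ler_powR ?gerBl// ltW.
    apply: (@le_trans _ _ (((2 * a) `^ a * expR (x / 2)) * expR (- x))).
      by rewrite ler_wpM2r ?expR_ge0// powR_le_expR ?(ltW x0).
    rewrite -mulrA -expRD /C.
    have -> : x / 2 - x = - 2^-1 * x by field.
    by rewrite le_eqVlt; apply/orP; left; apply/eqP; field.
rewrite ge0_integralD//; last 4 first.
- by move=> x _; rewrite lee_fin.
- exact/measurable_EFinP.
- by move=> x _; rewrite mule_ge0 ?lee_fin.
- apply: emeasurable_funM => //.
  by apply/measurable_EFinP; exact: measurable_exponential_pdf.
rewrite ge0_integralZl//; last 2 first.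
- by apply/measurable_EFinP; exact: measurable_exponential_pdf.
- by move=> x _; rewrite lee_fin.
rewrite integral_exponential_pdf// mule1 lte_add_pinfty ?ltry//.
rewrite (_ : (fun x => _) = EFin \o h1)// /h1.
rewrite -restrict_EFin -integral_mkcond.
by rewrite (le_lt_trans (integral_powR_01_le a0)) ?ltry.
Qed.

(** The real integral in [Gamma] is the finite part of an extended one, and a divergent integral
    would give 0; hence convergence comes first. *)
Lemma EFin_Gamma a : 0 < a -> (Gamma a)%:E = (\int[mu]_x (epker a x)%:E)%E.
Proof.
move=> a0; rewrite /Gamma /Rintegral.
rewrite [X in (fine X)%:E](_ : _ = (\int[mu]_x (epker a x)%:E)%E).
  rewrite fineK// ge0_fin_numE ?integral_epker_lty//.
  by apply: integral_ge0 => x _; rewrite lee_fin epker_ge0.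
rewrite -integral_itv_obnd_cbnd; last first.
  apply/measurable_EFinP; apply: measurable_funTS.
  apply: measurable_funM; first exact: measurable_powR.
  by apply: measurableT_comp => //; exact: measurable_funN.
rewrite integral_mkcond; apply: eq_integral => x _.
rewrite patchE mem_setE in_itv/= andbT /epker /pker.
by case: ifP; rewrite ?mul0r.
Qed.

Lemma Gamma_gt0 a : 0 < a -> 0 < Gamma a.
Proof.
move=> a0; rewrite -lte_fin EFin_Gamma//.
(* On [1, 2], s^(a-1) >= s^(-1) >= 1/2 since a > 0, and exp(-s) >= exp(-2). *)
apply: (@lt_le_trans _ _ (\int[mu]_(x in `[1%R, 2%R]) (2^-1 * expR (-2))%:E)%E).
  rewrite integral_cst//= lebesgue_measure_itv/= lte_fin ltr1n/= -EFinB -EFinM lte_fin.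
  by rewrite !mulr_gt0 ?expR_gt0//; lra.
apply: (@le_trans _ _ (\int[mu]_(x in `[1%R, 2%R]) (epker a x)%:E)%E).
  apply: ge0_le_integral => //.
  - by apply: measurable_funTS; exact: measurable_EFin_epker.
  - move=> x; rewrite /= in_itv/= => /andP[x1 x2]; rewrite lee_fin /epker /pker.
    rewrite (lt_le_trans ltr01 x1).
    rewrite ler_pM ?expR_ge0//; last by rewrite ler_expR lerN2.
    apply: (@le_trans _ _ (x `^ (-1))); last by rewrite ler_powR//; lra.
    rewrite powR_inv1; last lra.
    by rewrite lef_pV2 ?posrE//; lra.
apply: ge0_subset_integral => //; first exact: measurable_EFin_epker.
by move=> x _; rewrite lee_fin epker_ge0.
Qed.

Lemma Gamma1 : Gamma (1 : R) = 1.
Proof.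
apply: EFin_inj; rewrite EFin_Gamma//.
rewrite -(@integral_exponential_pdf R 1 ltr01).
rewrite [RHS](_ : _ = \int[mu]_(x in `[0%R, +oo[) (expR (- x))%:E)%E; last first.
  rewrite [RHS]integral_mkcond; apply: eq_integral => x _.
  rewrite restrict_EFin /exponential_pdf /=; congr EFin.
  by rewrite !patchE; case: ifP => // _; rewrite mul1r mulN1r.
rewrite -integral_itv_obnd_cbnd; last first.
  apply/measurable_EFinP; apply: measurable_funTS.
  by apply: measurableT_comp => //; exact: measurable_funN.
rewrite [RHS]integral_mkcond; apply: eq_integral => x _.
rewrite patchE mem_setE in_itv/= andbT /epker /pker.
by case: ifP; rewrite ?mul0r// subrr powRr0 mul1r.
Qed.

Lemma pkerM a c t : 0 < c -> pker a (c * t) = c `^ (a - 1) * pker a t.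
Proof.
move=> c0; rewrite /pker pmulr_rgt0//.
by case: ifP => t0; rewrite ?mulr0// powRM// ltW.
Qed.

(** The substitution s = t x pulls out t^(a-1), t^(b-1) and t. For t <= 0 one of s and t - s is
    nonpositive, and both sides vanish even if the constant is still infinite. *)
Lemma convol_pker_scale a b t :
  (convol (EFin \o pker a) (EFin \o pker b) t =
   convol (EFin \o pker a) (EFin \o pker b) 1 * (pker (a + b) t)%:E)%E.
Proof.
have [t0|t0] := ltP 0 t; last first.
  rewrite (pker_le0 _ t0) mule0; apply: integral0_eq => s _ /=.
  have [s0|s0] := ltP 0 s; last by rewrite (pker_le0 _ s0) mule0.
  by rewrite pker_le0 ?mul0e//; lra.
rewrite /convol (@ge0_integral_affine _ t 0)//; last 2 first.
- apply: emeasurable_funM; last exact: measurable_EFin_pker.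
  by apply: measurable_rshift; exact: measurable_EFin_pker.
- by move=> x; rewrite mule_ge0 ?lee_fin ?pker_ge0.
rewrite [LHS]muleC -[LHS]ge0_integralZr//; last 3 first.
- apply: emeasurable_funM; apply: (measurableT_comp (measurable_EFin_pker _)) => //.
    by apply: measurable_funB => //; apply: measurable_funD => //; exact: measurable_funM.
  by apply: measurable_funD => //; exact: measurable_funM.
- by move=> x _; rewrite mule_ge0 ?lee_fin ?pker_ge0.
- by rewrite lee_fin ltW.
rewrite -[RHS]ge0_integralZr//; last 3 first.
- apply: emeasurable_funM; last exact: measurable_EFin_pker.
  by apply: measurable_rshift; exact: measurable_EFin_pker.
- by move=> x _; rewrite mule_ge0 ?lee_fin ?pker_ge0.
- by rewrite lee_fin pker_ge0.
apply: eq_integral => x _ /=; rewrite -!EFinM; congr EFin.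
rewrite addr0 -{1}(mulr1 t) -mulrBr !pkerM// (pker_gt0 _ t0).
have -> : a + b - 1 = (a - 1) + (b - 1) + 1 by ring.
rewrite !powRD ?(gt_eqF t0) ?implybT// powRr1 ?ltW//.
by ring.
Qed.

(* Multiplying both kernels by exp(-t) multiplies their convolution by exp(-t);
   integrating over t gives Gamma a * Gamma b = B * Gamma (a + b), where B is the
   convolution at 1. *)
Lemma convol_pker a b t : 0 < a -> 0 < b ->
  (convol (EFin \o pker a) (EFin \o pker b) t =
   (Gamma a * Gamma b / Gamma (a + b) * pker (a + b) t)%:E)%E.
Proof.
move=> a0 b0; have ab0 : 0 < a + b by rewrite addr_gt0.
rewrite convol_pker_scale.
suff -> : (convol (EFin \o pker a) (EFin \o pker b) 1%R =
    (Gamma a * Gamma b / Gamma (a + b))%:E)%E by rewrite -EFinM.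
set B := convol _ _ _.
have B0 : (0 <= B)%E by apply: convol_ge0 => x; rewrite lee_fin pker_ge0.
have : (B * (Gamma (a + b))%:E = (Gamma a)%:E * (Gamma b)%:E)%E.
  rewrite (EFin_Gamma ab0) (EFin_Gamma a0) (EFin_Gamma b0).
  rewrite -(@integral_convol _ (EFin \o epker a) (EFin \o epker b)); last 4 first.
  - exact: measurable_EFin_epker.
  - exact: measurable_EFin_epker.
  - by move=> x; rewrite lee_fin epker_ge0.
  - by move=> x; rewrite lee_fin epker_ge0.
  rewrite -ge0_integralZl//; last 2 first.
  - exact: measurable_EFin_epker.
  - by move=> x _; rewrite lee_fin epker_ge0.
  apply: eq_integral => x _.
  rewrite {2}/epker EFinM muleA -convol_pker_scale /convol -ge0_integralZr//; last 2 first.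
  - apply: emeasurable_funM; last exact: measurable_EFin_pker.
    by apply: measurable_rshift; exact: measurable_EFin_pker.
  - by move=> y _; rewrite mule_ge0 ?lee_fin ?pker_ge0.
  apply: eq_integral => y _ /=; rewrite -!EFinM /epker; congr EFin.
  by rewrite -[in LHS](subrK y x) opprD expRD addrK; ring.
have G0 := Gamma_gt0 ab0.
(* The equation also shows that B is finite: as [Gamma (a + b)] is positive, an infinite B would
   make its left-hand side infinite. *)
case: B B0 => [r _| |]//.
  by rewrite -!EFinM => -[] <-; congr EFin; field; rewrite gt_eqF.
by rewrite gt0_mulye ?lte_fin.
Qed.

End Kernel.

(** * Fractional integrals of continuous functions *)

Section FractionalIntegral.
Context {R : realType}.
Local Notation mu := (@lebesgue_measure R).
Implicit Types (a b s t T M : R) (g h : R -> R).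

Definition cont T g := {within `[0, T], continuous g}.

Lemma contS T T' g : T' <= T -> cont T g -> cont T' g.
Proof.
move=> TT'; apply: continuous_subspaceW => x /=; rewrite !in_itv/=.
by move=> /andP[-> /le_trans]; exact.
Qed.

Lemma eq_cont T g h : (forall s : R, s \in `[0, T] -> g s = h s) ->
  cont T g -> cont T h.
Proof.
move=> gh; apply: subspace_eq_continuous => x.
by rewrite inE => /gh.
Qed.

Lemma cont_cst T (c : R) : cont T (fun=> c).
Proof. by move=> x; exact: cvg_cst. Qed.

Lemma contD T g h : cont T g -> cont T h -> cont T (fun s => g s + h s).
Proof. by move=> cg ch x; apply: cvgD; [exact: cg|exact: ch]. Qed.

Lemma contB T g h : cont T g -> cont T h -> cont T (fun s => g s - h s).
Proof. by move=> cg ch x; apply: cvgB; [exact: cg|exact: ch]. Qed.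

Lemma contZ T (c : R) g : cont T g -> cont T (fun s => c * g s).
Proof. by move=> cg x; apply: cvgM; [exact: cvg_cst|exact: cg]. Qed.

Lemma cont_measurable T g : cont T g -> measurable_fun `[0, T] g.
Proof. exact: subspace_continuous_measurable_fun. Qed.

Lemma cont_bounded T g : cont T g ->
  exists2 M : R, 0 <= M & forall s : R, s \in `[0, T] -> `|g s| <= M.
Proof.
move=> cg.
have /compact_bounded[M [_ gM]] := continuous_compact cg (@segment_compact R 0 T).
exists (`|M| + 1) => [|s s0T]; first by rewrite addr_ge0.
apply: gM; first by rewrite (le_lt_trans (ler_norm _))// ltrDl.
by exists s.
Qed.

(** [pker 1] is the indicator of the positive half-line, so this is [convol_pker] with b = 1. *)
Lemma integral_powR_sub a t : 0 < a -> 0 <= t ->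
  (\int[mu]_(s in `[0%R, t]) ((t - s) `^ (a - 1))%:E =
   (Gamma a / Gamma (a + 1) * t `^ a)%:E)%E.
Proof.
move=> a0; rewrite le_eqVlt => /predU1P[<-|t0].
  by rewrite set_itv1 integral_set1 powR0 ?gt_eqF// mulr0.
have mk D : measurable_fun D (fun s : R => ((t - s) `^ (a - 1))%:E).
  apply/measurable_EFinP; apply: measurable_funTS.
  apply: (measurableT_comp (measurable_powR (a - 1))).
  exact: measurable_funB.
rewrite integral_itv_bndoo; last exact: mk.
have -> : Gamma a / Gamma (a + 1) * t `^ a =
    Gamma a * Gamma 1 / Gamma (a + 1) * pker (a + 1) t.
  by rewrite Gamma1 mulr1 pker_gt0// addrK.
rewrite -convol_pker// integral_mkcond; apply: eq_integral => s _ /=.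
rewrite patchE mem_setE in_itv/= -EFinM.
have [s0|s0] := ltP 0 s; last by rewrite (pker_le0 _ s0) mulr0.
rewrite (pker_gt0 _ s0) subrr powRr0 mulr1.
have [st|st]/= := ltP s t; first by rewrite pker_gt0// subr_gt0.
by rewrite pker_le0// subr_le0.
Qed.

Lemma powR_sub_integrable a t : 0 < a ->
  mu.-integrable `[0, t] (EFin \o (fun s => (t - s) `^ (a - 1))).
Proof.
move=> a0; have [t0|t0] := leP 0 t; last first.
  by rewrite set_itv_ge ?bnd_simp -?ltNge//; exact: integrable_set0.
apply/integrableP; split.
  apply/measurable_EFinP; apply: measurable_funTS.
  apply: (measurableT_comp (measurable_powR (a - 1))).
  exact: measurable_funB.
under eq_integral do rewrite /= ger0_norm ?powR_ge0//.
by rewrite integral_powR_sub// ltry.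
Qed.

Lemma RLint_integrable a g t : 0 < a -> cont t g ->
  mu.-integrable `[0, t] (EFin \o (fun s => (t - s) `^ (a - 1) * g s)).
Proof.
move=> a0 cg.
have [M M0 gM] := cont_bounded cg.
have bg : [bounded g x | x in `[0, t]%classic].
  by exists M; split; [exact: num_real|] => M' MM' x /gM /le_trans; apply; exact: ltW.
exact: (integrableMl _ (powR_sub_integrable t a0) (cont_measurable cg) bg).
Qed.

Lemma eq_RLint a g h t : (forall s : R, s \in `[0, t] -> g s = h s) ->
  RLint a g t = RLint a h t.
Proof.
move=> gh; rewrite /RLint; congr (_ * _); apply: eq_Rintegral => s.
by rewrite inE => /gh ->.
Qed.

Lemma RLintD a g h t : 0 < a -> cont t g -> cont t h ->
  RLint a (fun s => g s + h s) t = RLint a g t + RLint a h t.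
Proof.
move=> a0 cg ch; rewrite /RLint -mulrDr; congr (_ * _).
rewrite -RintegralD//; [|exact: RLint_integrable..].
by apply: eq_Rintegral => s _; rewrite mulrDr.
Qed.

Lemma RLintB a g h t : 0 < a -> cont t g -> cont t h ->
  RLint a (fun s => g s - h s) t = RLint a g t - RLint a h t.
Proof.
move=> a0 cg ch; rewrite /RLint -mulrBr; congr (_ * _).
rewrite -RintegralB//; [|exact: RLint_integrable..].
by apply: eq_Rintegral => s _; rewrite mulrBr.
Qed.

Lemma RLintZ a (c : R) g t : 0 < a -> cont t g ->
  RLint a (fun s => c * g s) t = c * RLint a g t.
Proof.
move=> a0 cg; rewrite /RLint mulrCA; congr (_ * _).
rewrite -RintegralZl//; last exact: RLint_integrable.
by apply: eq_Rintegral => s _; rewrite mulrCA.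
Qed.

Lemma RLint_cst a (c : R) t : 0 < a -> 0 <= t ->
  RLint a (fun=> c) t = c * (t `^ a / Gamma (a + 1)).
Proof.
move=> a0 t0.
have -> : RLint a (fun=> c) t = c * RLint a (fun=> 1) t.
  rewrite -RLintZ//; last exact: cont_cst.
  by apply: eq_RLint => s _; rewrite mulr1.
congr (_ * _); rewrite /RLint /Rintegral.
under eq_integral do rewrite mulr1.
rewrite integral_powR_sub//= -[_ / _ * _]mulrA mulKf ?gt_eqF ?Gamma_gt0//.
by rewrite mulrC.
Qed.

Lemma RLint_ge0 a g t : 0 < a -> (forall s, s \in `[0, t] -> 0 <= g s) ->
  0 <= RLint a g t.
Proof.
move=> a0 g0; rewrite /RLint mulr_ge0 ?invr_ge0 ?(ltW (Gamma_gt0 _))//.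
by apply: Rintegral_ge0 => s /g0 gs; rewrite mulr_ge0 ?powR_ge0.
Qed.

Lemma RLint_le a g t M : 0 < a -> 0 <= t -> cont t g ->
  (forall s, s \in `[0, t] -> `|g s| <= M) ->
  `|RLint a g t| <= M * (t `^ a / Gamma (a + 1)).
Proof.
move=> a0 t0 cg gM; rewrite -RLint_cst// ler_norml; apply/andP; split.
  rewrite -subr_ge0 opprK -RLintD//; last exact: cont_cst.
  apply: RLint_ge0 => // s /gM; rewrite ler_norml => /andP[]; lra.
rewrite -subr_ge0 -RLintB//; last exact: cont_cst.
apply: RLint_ge0 => // s /gM; rewrite ler_norml => /andP[]; lra.
Qed.

Lemma measurable_EFin_patch T g : cont T g ->
  measurable_fun setT (EFin \o (g \_ `]0, T])).
Proof.
move=> cg; apply/measurable_EFinP; apply/(measurable_restrictT _ _).1 => //.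
apply: measurable_funS (cont_measurable cg) => //.
exact: subset_itv_oc_cc.
Qed.

Lemma patch_ge0 T g : (forall s, s \in `[0, T] -> 0 <= g s) ->
  forall s, (0 <= (EFin \o (g \_ `]0%R, T])) s)%E.
Proof.
move=> g0 s; rewrite /= lee_fin patchE mem_setE.
case: ifP => // s0T; apply: g0.
by move: s0T; rewrite !in_itv/= => /andP[/ltW -> ->].
Qed.

(** Cutting g off at a fixed T >= t, and not at t, lets one patched function represent [RLint a g]
    at every point of [0, T], as iterating the convolution requires. *)
Lemma convol_RLint a g t T : 0 < a -> t <= T -> cont T g ->
  (forall s, s \in `[0, T] -> 0 <= g s) ->
  convol (EFin \o pker a) (EFin \o (g \_ `]0, T])) t =
  (Gamma a * RLint a g t)%:E.
Proof.
move=> a0 tT cg g0.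
have cgt := contS tT cg.
rewrite /RLint mulrA divff ?gt_eqF ?Gamma_gt0// mul1r /Rintegral fineK; last first.
  exact: integrable_fin_num (RLint_integrable a0 cgt).
have mk : measurable_fun `]0, t[ (fun s : R => ((t - s) `^ (a - 1) * g s)%:E).
  apply: measurable_funS (measurable_int _ (RLint_integrable a0 cgt)) => //.
  exact: subset_itv_oo_cc.
rewrite [RHS]integral_itv_bndoo// [RHS]integral_mkcond.
apply: eq_integral => s _ /=.
rewrite !patchE !mem_setE !in_itv/=.
have [s0|s0]/= := ltP 0 s; last by rewrite mule0.
have [st|st]/= := ltP s t; last by rewrite pker_le0 ?mul0e ?subr_le0.
by rewrite (le_trans (ltW st) tT) pker_gt0 ?subr_gt0// EFinM.
Qed.

End FractionalIntegral.

(** * Continuity and the semigroup law *)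

Section FractionalIntegralContinuity.
Context {R : realType}.
Local Notation mu := (@lebesgue_measure R).
Implicit Types (a b s t T M : R) (g h : R -> R).

(** The retraction of the line onto [0, T]: composing with it extends a function continuous on
    [0, T] to one continuous everywhere. *)
Definition clamp T s : R := Num.max 0 (Num.min s T).

Lemma clamp_in T s : 0 <= T -> clamp T s \in `[0, T].
Proof.
move=> T0; rewrite in_itv/= /clamp le_max lexx/= ge_max T0/= ge_min lexx.
by rewrite orbT.
Qed.

Lemma clampK T s : s \in `[0, T] -> clamp T s = s.
Proof.
by rewrite in_itv/= => /andP[s0 sT]; rewrite /clamp min_l// max_r.
Qed.

Lemma clamp_dist T s t : `|clamp T s - clamp T t| <= `|s - t|.
Proof.
rewrite /clamp.
suff H x y : clamp T x - clamp T y <= `|x - y|.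
  by rewrite ler_norml lerNl opprB {1}distrC !H.
rewrite /clamp lerBlDr ge_max addr_ge0 ?le_max ?lexx//=.
have := ler_norm (x - y); rewrite ge_min; have [yT|yT] := leP y T => xy.
  by apply/orP; left; apply: (@le_trans _ _ (`|x - y| + y)); [lra|];
     rewrite lerD2l le_max lexx orbT.
by apply/orP; right; rewrite ler_wpDl// le_max lexx orbT.
Qed.

Lemma contP T g : cont T g <-> forall t, t \in `[0, T] -> forall e : R, 0 < e ->
  exists2 d : R, 0 < d & forall s, s \in `[0, T] -> `|s - t| < d -> `|g s - g t| <= e.
Proof.
split=> [/subspace_continuousP cg t tT e e0|H].
  have /cvgrPdist_le/(_ _ e0) := cg t tT.
  rewrite near_withinE => /nbhs_ballP[d/= d0 dP].
  exists d => // s sT st; rewrite distrC; apply: dP => //.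
  by rewrite /ball/= distrC.
apply/subspace_continuousP => t tT; apply/cvgrPdist_le => e e0.
have [d d0 dP] := H t tT e e0.
rewrite near_withinE; apply/nbhs_ballP; exists d => //= s.
by rewrite /ball/= distrC => st sT; rewrite distrC; exact: dP.
Qed.

Lemma cont_clamp T g : 0 <= T -> cont T g -> continuous (g \o clamp T).
Proof.
move=> T0 /contP cg t; apply/cvgrPdist_le => e e0.
have [d d0 dP] := cg _ (clamp_in t T0) e e0.
apply/nbhs_ballP; exists d => //= s; rewrite /ball/= => st.
rewrite distrC; apply: dP; first exact: clamp_in.
by rewrite (le_lt_trans (clamp_dist _ _ _))// distrC.
Qed.

Lemma cont_comp_scale t T g : 0 <= t <= T -> cont T g -> cont 1 (fun u => g (t * u)).
Proof.
move=> /andP[t0 tT] cg.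
have T0 := le_trans t0 tT.
apply: (@eq_cont _ _ (fun u => (g \o clamp T) (t * u))).
  move=> u; rewrite in_itv/= => /andP[u0 u1] /=.
  rewrite clampK// in_itv/= mulr_ge0//= (le_trans _ tT)//.
  by rewrite ler_piMr.
apply: continuous_subspaceT => u.
apply: (@continuous_comp _ _ _ ( *%R t) (g \o clamp T)).
  exact: mulrl_continuous.
exact: cont_clamp.
Qed.

(* The substitution s = t * u moves t out of the singular kernel, so that
   continuity in t is continuity under the integral sign. *)
Lemma RLint_scale a g t : 0 < a -> 0 <= t -> cont t g ->
  RLint a g t = t `^ a * RLint a (fun u => g (t * u)) 1.
Proof.
move=> a0; rewrite le_eqVlt => /predU1P[<- cg|t0].
  rewrite powR0 ?gt_eqF// mul0r /RLint set_itv1 /Rintegral integral_set1 /=.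
  by rewrite mulr0.
(* Both sides are linear in g and explicit on constants, so g may be replaced by g + M with M a
   bound of |g|. *)
wlog g0 : g / forall s, s \in `[0, t] -> 0 <= g s => [hwlog cg|cg].
  have [M M0 gM] := cont_bounded cg.
  have cM s : cont s (fun=> M) by exact: cont_cst.
  have c1 : cont 1 (fun u => g (t * u)).
    by apply: (cont_comp_scale _ cg); rewrite (ltW t0) lexx.
  have gM0 s : s \in `[0, t] -> 0 <= g s + M.
    by move=> /gM; rewrite ler_norml => /andP[]; lra.
  have := hwlog _ gM0 (contD cg (cM t)).
  rewrite !RLintD// !RLint_cst ?(ltW t0)// powR1 mulrDr mul1r => H.
  by apply: (addIr (M * (t `^ a / Gamma (a + 1)))); rewrite H; congr (_ + _); ring.
have c1 : cont 1 (fun u => g (t * u)).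
  by apply: (cont_comp_scale _ cg); rewrite (ltW t0) lexx.
have G0 := Gamma_gt0 a0.
have g10 u : u \in `[0, 1] -> 0 <= g (t * u).
  rewrite in_itv/= => /andP[u0 u1]; apply: g0.
  by rewrite in_itv/= mulr_ge0 ?(ltW t0)// ler_piMr ?(ltW t0).
apply: (mulfI (lt0r_neq0 G0)); apply: EFin_inj.
rewrite -(convol_RLint a0 (lexx t) cg g0) mulrCA EFinM.
rewrite -(convol_RLint a0 (lexx 1) c1 g10).
have mp (c : R) : measurable_fun setT (fun s : R => (EFin \o pker a) (c - s)).
  by apply: measurable_rshift; exact: measurable_EFin_pker.
rewrite /convol (@ge0_integral_affine _ t 0)//; last 2 first.
- by apply: emeasurable_funM => //; exact: measurable_EFin_patch.
- by move=> x; rewrite mule_ge0 ?patch_ge0// lee_fin pker_ge0.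
have -> : t `^ a = t * t `^ (a - 1) by rewrite mulr_powRB1// ltW.
rewrite EFinM -muleA; congr (_ * _)%E.
rewrite -ge0_integralZl//; last 3 first.
- by apply: emeasurable_funM; [exact: mp|exact: (measurable_EFin_patch c1)].
- by move=> x _; rewrite mule_ge0 ?patch_ge0// lee_fin pker_ge0.
- by rewrite lee_fin powR_ge0.
apply: eq_integral => u _ /=.
rewrite addr0 -{1}(mulr1 t) -mulrBr pkerM// EFinM -muleA; congr (_ * (_ * _%:E))%E.
rewrite !patchE !mem_setE !in_itv/= pmulr_rgt0//.
by rewrite -[X in t * u <= X]mulr1 ler_pM2l.
Qed.

Lemma cont_RLint a g T : 0 < a -> cont T g -> cont T (RLint a g).
Proof.
move=> a0 cg; have [T0|T0] := ltP T 0.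
  by apply/contP => t; rewrite in_itv/= => /andP[/le_trans H /H]; lra.
pose gc := g \o clamp T.
have cgc : continuous gc by exact: cont_clamp.
pose J (t : R) := \int[mu]_(u in `[0, 1]) ((1 - u) `^ (a - 1) * gc (t * u)).
have [M M0 gM] := cont_bounded cg.
(* Dominated convergence, with M (1 - u)^(a-1) as dominating function. The open parameter interval
   makes 0 and T interior points; [clamp] gives the integrand a meaning outside [0, T]. *)
have cJ : {in `]-1, (T + 1)[%classic, continuous J}.
  apply: (@continuity_under_integral R _ _ mu
    (fun t u => (1 - u) `^ (a - 1) * gc (t * u)) _ _ _ _ _ _
    (fun u => (1 - u) `^ (a - 1) * M)) => //.
  - move=> t _; apply: RLint_integrable => //.
    apply: continuous_subspaceT => u.
    apply: (@continuous_comp _ _ _ ( *%R t) gc); last exact: cgc.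
    exact: mulrl_continuous.
  - apply: aeW => u _ t _; apply: cvgM; first exact: cvg_cst.
    apply: (@cvg_comp _ _ _ (fun x => x * u) gc _ (nbhs (t * u))).
      exact: mulrr_continuous.
    exact: cgc.
  - by apply: RLint_integrable => //; exact: cont_cst.
  - move=> t _; apply: aeW => u _.
    rewrite normrM ger0_norm ?powR_ge0// ler_wpM2l ?powR_ge0//.
    by apply: gM; exact: clamp_in.
apply: (@eq_cont _ _ (fun t => t `^ a * ((Gamma a)^-1 * J t))).
  move=> t; rewrite in_itv/= => /andP[t0 tT].
  rewrite (RLint_scale a0 t0 (contS tT cg)); congr (_ * _).
  rewrite /RLint; congr (_ * _); apply: eq_Rintegral => u.
  rewrite inE/= in_itv/= => /andP[u0 u1]; congr (_ * _).
  rewrite /gc/= clampK// in_itv/= mulr_ge0//= (le_trans _ tT)//.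
  by rewrite ler_piMr.
apply/subspace_continuousP => t /=; rewrite in_itv/= => /andP[t0 tT].
apply: cvgM; last first.
  apply: cvgM; first exact: cvg_cst.
  apply: cvg_within_filter; apply: cJ.
  by rewrite inE/= in_itv/=; apply/andP; split; lra.
(* At 0 the power t^a need not be differentiable; its continuity there is checked by hand with
   radius e^(1/a). *)
move: t0; rewrite le_eqVlt => /predU1P[<-|t0].
  rewrite powR0 ?gt_eqF//; apply/cvgrPdist_le => e e0.
  rewrite near_withinE; apply/nbhs_ballP; exists (e `^ a^-1).
    by rewrite /= powR_gt0.
  move=> s; rewrite /ball/= sub0r normrN => se; rewrite in_itv/= => /andP[s0 _].
  rewrite sub0r normrN ger0_norm ?powR_ge0//.
  move: se; rewrite ger0_norm// => /ltW se.
  have -> : e = (e `^ a^-1) `^ a by rewrite -powRrM mulVf ?gt_eqF// powRr1// ltW.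
  by rewrite ge0_ler_powR ?nnegrE ?powR_ge0 ?(ltW a0).
apply: cvg_within_filter.
apply: (@differentiable_continuous _ _ _ _ (fun s => s `^ a)).
by apply/derivable1_diffP; apply: derivable_powR; rewrite in_itv/= andbT.
Qed.

Lemma RLint_comp a b g t : 0 < a -> 0 < b -> 0 <= t -> cont t g ->
  RLint a (RLint b g) t = RLint (a + b) g t.
Proof.
move=> a0 b0 t0.
have ab0 : 0 < a + b by rewrite addr_gt0.
wlog g0 : g / forall s, s \in `[0, t] -> 0 <= g s => [hwlog cg|cg].
  have [M M0 gM] := cont_bounded cg.
  have cM : cont t (fun=> M) by exact: cont_cst.
  have gM0 s : s \in `[0, t] -> 0 <= g s + M.
    by move=> /gM; rewrite ler_norml => /andP[]; lra.
  have := hwlog _ gM0 (contD cg cM).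
  rewrite (@eq_RLint _ _ _ (fun s => RLint b g s + RLint b (fun=> M) s)); last first.
    move=> s; rewrite in_itv/= => /andP[_ st].
    by rewrite RLintD//; exact: contS st _.
  rewrite RLintD; [|by []|exact: cont_RLint..].
  (* The constant M is itself nonnegative, so its own instance of the law cancels from both
     sides. *)
  rewrite (hwlog (fun=> M))//.
  by rewrite RLintD// => /addIr.
have cb := cont_RLint b0 cg.
have Ga := Gamma_gt0 a0.
have Gb := Gamma_gt0 b0.
have Gab := Gamma_gt0 ab0.
have RLg0 s : s \in `[0, t] -> 0 <= RLint b g s.
  rewrite in_itv/= => /andP[_ st]; apply: RLint_ge0 => // r.
  rewrite in_itv/= => /andP[r0 rs]; apply: g0.
  by rewrite in_itv/= r0 (le_trans rs).
apply: (mulfI (lt0r_neq0 (mulr_gt0 Ga Gb))); apply: EFin_inj.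
have mp := measurable_EFin_patch cg.
have p0 := patch_ge0 g0.
have kb0 (c : R) x : (0 <= (EFin \o pker c) x)%E by rewrite lee_fin pker_ge0.
have <- : convol (EFin \o pker a)
    (convol (EFin \o pker b) (EFin \o (g \_ `]0, t]))) t =
    (Gamma a * Gamma b * RLint (a + b) g t)%:E.
  rewrite convolA//; last 2 first.
  - exact: measurable_EFin_pker.
  - exact: measurable_EFin_pker.
  have -> : Gamma a * Gamma b * RLint (a + b) g t =
      Gamma a * Gamma b / Gamma (a + b) * (Gamma (a + b) * RLint (a + b) g t).
    by field; rewrite gt_eqF.
  rewrite EFinM -(convol_RLint ab0 (lexx t) cg g0) /convol -ge0_integralZl//; last 3 first.
  - apply: emeasurable_funM => //.
    by apply: measurable_rshift; exact: measurable_EFin_pker.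
  - by move=> x _; rewrite mule_ge0.
  - by rewrite lee_fin divr_ge0 ?mulr_ge0 ?ltW.
  apply: eq_integral => s _; rewrite muleA; congr (_ * _)%E.
  by rewrite -/(convol _ _ _) convol_pker// -EFinM.
rewrite [Gamma a * _]mulrC -mulrA EFinM -(convol_RLint a0 (lexx t) cb RLg0).
rewrite /convol -ge0_integralZl//; last 3 first.
- apply: emeasurable_funM => //; last exact: measurable_EFin_patch.
  by apply: measurable_rshift; exact: measurable_EFin_pker.
- by move=> x _; rewrite mule_ge0//; exact: patch_ge0.
- by rewrite lee_fin ltW.
apply: eq_integral => s _; rewrite muleCA.
have [st|st] := ltP s t; last by rewrite /= pker_le0 ?mul0e// subr_le0.
congr (_ * _)%E; rewrite /= patchE mem_setE in_itv/= (ltW st) andbT.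
have [s0|s0] := ltP 0 s.
  by rewrite -EFinM -(convol_RLint b0 (ltW st) cg g0).
(* For s <= 0 the inner convolution vanishes, in agreement with the cut-off of [RLint b g]. *)
rewrite mule0; apply/esym; apply: integral0_eq => r _ /=.
rewrite patchE mem_setE in_itv/=.
have [r0|r0]/= := ltP 0 r; last by rewrite mule0.
by rewrite pker_le0 ?mul0e//; lra.
Qed.

End FractionalIntegralContinuity.

(** * One-sided derivatives on the unit interval *)

Section Derivatives01.
Context {R : realType}.
Local Notation mu := (@lebesgue_measure R).
Implicit Types (a b s t T M l e d : R) (g h : R -> R).

(** Naming the limit keeps existence and value together; [deriv01] alone has a default value where
    the quotient diverges. *)
Definition is01 g t l := quot01 g t s @[s --> within `[0, 1] t^'] --> l.

Lemma is01P g t l : is01 g t l <-> forall e, 0 < e ->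
  exists2 d : R, 0 < d & forall s : R, s \in `[0, 1] -> `|s - t| < d ->
    `|g s - g t - l * (s - t)| <= e * `|s - t|.
Proof.
have E s : s != t -> g s - g t - l * (s - t) = - (l - quot01 g t s) * (s - t).
  by move=> st; rewrite /quot01; field; rewrite subr_eq0.
split=> [/cvgrPdist_le H e e0|H].
  have := H e e0; rewrite !near_withinE => /nbhs_ballP[d /= d0 dP].
  exists d => // s s01 st.
  have [->|nst] := eqVneq s t; first by rewrite !subrr mulr0 subrr normr0 mulr0.
  rewrite E// normrM normrN ler_wpM2r//; apply: dP => //.
  by rewrite /ball/= distrC.
apply/cvgrPdist_le => e e0; have [d d0 dP] := H e e0.
rewrite !near_withinE; apply/nbhs_ballP; exists d => //= s.
rewrite /ball/= distrC => st nst s01.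
have := dP s s01 st; rewrite E// normrM normrN ler_pM2r//.
by rewrite normr_gt0 subr_eq0.
Qed.

(** Derivatives are unique because [0, 1] accumulates at t, endpoints included: a step of at most
    1/2 stays inside if it goes right from t <= 1/2 and left otherwise. *)
Lemma proper01 t : t \in `[0, 1] -> ProperFilter (within `[0, 1] t^').
Proof.
rewrite in_itv/= => /andP[t0 t1]; split; last by apply: within_filter.
change (~ \forall s \near within `[0, 1]%classic t^', False).
rewrite !near_withinE => /nbhs_ballP[d /= d0 dP].
pose d' := Num.min d 1 / 2.
have d'0 : 0 < d' by rewrite divr_gt0// lt_min d0 ltr01.
have [d'd d'1] : d' < d /\ d' <= 2^-1.
  by rewrite /d'; have [] := leP d 1; split; lra.
have [th|th] := leP t 2^-1.
  apply: (dP (t + d')); rewrite /ball /= ?in_itv/=.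
  - by rewrite opprD addrA subrr sub0r normrN gtr0_norm.
  - by rewrite -subr_eq0 addrAC subrr add0r gt_eqF.
  - by apply/andP; split; lra.
apply: (dP (t - d')); rewrite /ball /= ?in_itv/=.
- by rewrite opprB addrC subrK gtr0_norm.
- by rewrite -subr_eq0 addrAC subrr sub0r oppr_eq0 gt_eqF.
- by apply/andP; split; lra.
Qed.

Lemma is01_deriv g t l : t \in `[0, 1] -> is01 g t l -> deriv01 g t = l.
Proof. by move=> /proper01 P; exact: cvg_lim. Qed.

Lemma is01_derivable g t l : is01 g t l -> derivable01 g t.
Proof. by move=> H; apply/cvg_ex; exists l. Qed.

Lemma derivable01_is01 g t : derivable01 g t -> is01 g t (deriv01 g t).
Proof. by []. Qed.

Lemma near_is01 g h t l d : 0 < d -> t \in `[0, 1] ->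
  (forall s, s \in `[0, 1] -> `|s - t| < d -> g s = h s) ->
  is01 g t l -> is01 h t l.
Proof.
move=> d0 t01 gh /is01P H; apply/is01P => e /H[d' d'0 d'P].
exists (Num.min d d'); first by rewrite lt_min d0.
move=> s s01; rewrite lt_min => /andP[sd sd'].
by rewrite -!gh ?subrr ?normr0//; exact: d'P.
Qed.

Lemma eq_is01 g h t l : t \in `[0, 1] -> (forall s : R, s \in `[0, 1] -> g s = h s) ->
  is01 g t l -> is01 h t l.
Proof. by move=> t01 gh; apply: (@near_is01 _ _ _ _ 1) => // s /gh. Qed.

Lemma itv_oo_cc T t : T <= 1 -> t \in `]0, T[ -> t \in `[0, 1].
Proof. by rewrite !in_itv/= => T1 /andP[t0 tT]; apply/andP; split; lra. Qed.

Lemma eq_is01_oo T g h t l : T <= 1 -> t \in `]0, T[ ->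
  (forall s : R, s \in `]0, T[ -> g s = h s) ->
  is01 g t l -> is01 h t l.
Proof.
move=> T1 t0T gh; have t01 := itv_oo_cc T1 t0T.
move: t0T; rewrite in_itv/= => /andP[t0 tT].
apply: (@near_is01 _ _ _ _ (Num.min t (T - t))) => //.
  by rewrite lt_min t0 subr_gt0.
move=> s s01; rewrite lt_min => /andP[st sT]; apply: gh.
rewrite in_itv/=; apply/andP; split.
  by move: st; rewrite ltr_norml => /andP[]; lra.
by move: sT; rewrite ltr_norml => /andP[]; lra.
Qed.

Lemma is01_cst (c : R) t : is01 (fun=> c) t 0.
Proof.
apply/is01P => e e0; exists 1 => // s _ _.
by rewrite subrr mul0r subrr normr0 mulr_ge0// ltW.
Qed.

Lemma is01D g h t l l' : is01 g t l -> is01 h t l' ->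
  is01 (fun s => g s + h s) t (l + l').
Proof.
move=> Hg Hh; rewrite /is01 (_ : quot01 _ _ = fun s => quot01 g t s + quot01 h t s).
  exact: cvgD.
by apply/funext => s; rewrite /quot01 -mulrDl; congr (_ / _); ring.
Qed.

Lemma is01Z (c : R) g t l : is01 g t l -> is01 (fun s => c * g s) t (c * l).
Proof.
move=> Hg; rewrite /is01 (_ : quot01 _ _ = fun s => c * quot01 g t s).
  by apply: cvgM => //; exact: cvg_cst.
by apply/funext => s; rewrite /quot01 -mulrBr mulrA.
Qed.

Lemma is01B g h t l l' : is01 g t l -> is01 h t l' ->
  is01 (fun s => g s - h s) t (l - l').
Proof.
move=> Hg /(@is01Z (-1)) Hh; have := is01D Hg Hh.
rewrite mulN1r (_ : (fun s => _) = (fun s => g s - h s))//.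
by apply/funext => s; rewrite mulN1r.
Qed.

Lemma is01_cont_at g t l : is01 g t l -> forall e, 0 < e ->
  exists2 d : R, 0 < d & forall s : R, s \in `[0, 1] -> `|s - t| < d -> `|g s - g t| <= e.
Proof.
move=> /is01P H e e0; have [d d0 dP] := H 1 ltr01.
have l1 : 0 < `|l| + 1 by rewrite ltr_wpDl.
exists (Num.min d (e / (`|l| + 1))); first by rewrite lt_min d0 divr_gt0.
move=> s s01; rewrite lt_min ltr_pdivlMr// => /andP[/(dP _ s01) H1 H2].
rewrite -(subrK (l * (s - t)) (g s - g t)) (le_trans (ler_normD _ _))//.
apply: le_trans (ltW H2); rewrite [leRHS]mulrDr mulr1 addrC lerD//.
  by rewrite normrM mulrC.
by rewrite mul1r in H1.
Qed.

Lemma is01_cont g : (forall t, t \in `[0, 1] -> exists l, is01 g t l) -> cont 1 g.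
Proof. by move=> H; apply/contP => t /H[l /is01_cont_at]. Qed.

Lemma is_deriveP g t l : is_derive t 1 g l <-> forall e, 0 < e ->
  exists2 d : R, 0 < d & forall s : R, `|s - t| < d ->
    `|g s - g t - l * (s - t)| <= e * `|s - t|.
Proof.
pose q (h : R) := h^-1 *: ((g \o shift t) (h *: (1 : R)) - g t).
have E s : s != t -> g s - g t - l * (s - t) = - (l - q (s - t)) * (s - t).
  have -> : q (s - t) = (s - t)^-1 * (g s - g t).
    by rewrite /q /= [_ *: 1]mulr1 subrK.
  by move=> st; field; rewrite subr_eq0.
suff : q h @[h --> 0^'] --> l <-> forall e, 0 < e ->
  exists2 d : R, 0 < d & forall s : R, `|s - t| < d ->
    `|g s - g t - l * (s - t)| <= e * `|s - t|.
  move=> [H1 H2]; split=> [[H Hl]|/H2 H]; first by apply: H1; rewrite -Hl; exact: H.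
  by split; [apply/cvg_ex; exists l|exact: cvg_lim].
split=> [/cvgrPdist_le H e e0|H].
  have := H e e0; rewrite !near_withinE => /nbhs_ballP[d /= d0 dP].
  exists d => // s st.
  have [->|nst] := eqVneq s t; first by rewrite !subrr mulr0 subrr normr0 mulr0.
  rewrite E// normrM normrN ler_wpM2r//; apply: dP; last by rewrite subr_eq0.
  by rewrite /ball/= sub0r normrN.
apply/cvgrPdist_le => e e0; have [d d0 dP] := H e e0.
rewrite !near_withinE; apply/nbhs_ballP; exists d => //= h.
rewrite /ball/= sub0r normrN => hd h0.
have nt : h + t != t by rewrite -subr_eq0 addrK.
have := dP (h + t); rewrite E// addrK => /(_ hd).
by rewrite normrM normrN ler_pM2r// normr_gt0.
Qed.

Lemma is_derive_is01 g t l : is_derive t 1 g l -> is01 g t l.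
Proof.
move=> /is_deriveP H; apply/is01P => e /H[d d0 dP].
by exists d => // s _; exact: dP.
Qed.

Lemma is01_is_derive g t l : t \in `]0, 1[ -> is01 g t l -> is_derive t 1 g l.
Proof.
rewrite in_itv/= => /andP[t0 t1] /is01P H; apply/is_deriveP => e /H[d d0 dP].
exists (Num.min d (Num.min t (1 - t))); first by rewrite !lt_min d0 t0 subr_gt0.
move=> s; rewrite !lt_min => /and3P[sd st sT]; apply: dP => //.
rewrite in_itv/=; apply/andP; split.
  by move: st; rewrite ltr_norml => /andP[]; lra.
by move: sT; rewrite ltr_norml => /andP[]; lra.
Qed.

Lemma is01_eq0_cst T g : T <= 1 -> cont T g ->
  (forall t, t \in `]0, T[ -> is01 g t 0) ->
  forall t, t \in `[0, T] -> g t = g 0.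
Proof.
move=> T1 cg dg t; rewrite in_itv/= => /andP[t0 tT].
have dg0 x : x \in `]0, t[ -> is_derive x 1 g 0.
  rewrite in_itv/= => /andP[x0 xt]; apply: is01_is_derive.
    by rewrite in_itv/=; apply/andP; split; lra.
  by apply: dg; rewrite in_itv/= x0 (lt_le_trans xt).
have [c _] := MVT_segment t0 dg0 (contS tT cg).
by rewrite mul0r => /eqP; rewrite subr_eq0 => /eqP.
Qed.

Lemma RLint1E g t : RLint 1 g t = \int[mu]_(s in `[0, t]) g s.
Proof.
rewrite /RLint Gamma1 invr1 mul1r; apply: eq_Rintegral => s _.
by rewrite subrr powRr0 mul1r.
Qed.

Lemma is01_RLint1 g t : cont 1 g -> t \in `[0, 1] -> is01 (RLint 1 g) t (g t).
Proof.
(* Extending g to [-1, 2] makes 0 and 1 interior, so the two-sided fundamental theorem covers the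
   endpoints. *)
move=> cg t01; pose gc := g \o clamp 1.
have cgc : continuous gc by exact: cont_clamp.
have igc (u v : R) : mu.-integrable `[u, v] (EFin \o gc).
  apply: continuous_compact_integrable; first exact: segment_compact.
  exact: continuous_subspaceT.
have := t01; rewrite in_itv/= => /andP[t0 t1].
have t2 : t < 2 by lra.
have tm1 : -1 < t by lra.
have [D1 D2] := continuous_FTC1_closed t2 (igc (-1) 2) tm1 (cgc t).
set F := (fun x : R => _) in D1 D2.
have D3 : 'D_1 F t = gc t by rewrite -derive1E; exact: D2.
have dF : is_derive t 1 F (gc t) := DeriveDef D1 D3.
have gct : gc t = g t by rewrite /gc/= clampK.
have := is01B (is_derive_is01 dF) (is01_cst (F 0) t).
rewrite subr0 gct; apply: eq_is01 => // s.
rewrite in_itv/= => /andP[s0 s1].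
rewrite RLint1E /F (@Rintegral_itvB _ _ (BLeft (-1)) (BRight s) 0)//.
- rewrite Rintegral_itv_obnd_cbnd; last first.
    by apply: integrableS (igc 0 s) => //; exact: subset_itv_oc_cc.
  apply: eq_Rintegral => r; rewrite inE/= in_itv/= => /andP[r0 rs].
  by rewrite /gc/= clampK// in_itv/= r0 (le_trans rs).
- by rewrite bnd_simp; lra.
Qed.

Lemma cont_C1 g u : (forall t, t \in `[0, 1] -> is01 g t (u t)) -> cont 1 g.
Proof. by move=> H; apply: is01_cont => t /H; exists (u t). Qed.

Lemma RLint1_deriv g u : cont 1 u ->
  (forall t, t \in `[0, 1] -> is01 g t (u t)) ->
  forall t, t \in `[0, 1] -> RLint 1 u t = g t - g 0.
Proof.
move=> cu dg t t01.
have cg := cont_C1 dg.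
have c1 : cont 1 (RLint 1 u) by exact: cont_RLint.
have := is01_eq0_cst (lexx 1) (contB cg c1) _ t01.
have -> : RLint 1 u 0 = 0 by rewrite RLint1E set_itv1 Rintegral_set1.
rewrite subr0 => <-; first by rewrite subKr.
move=> s /(itv_oo_cc (lexx 1)) s01.
by rewrite -(subrr (u s)); apply: is01B; [exact: dg|exact: is01_RLint1].
Qed.

Lemma RLint_at0 a g : RLint a g 0 = 0.
Proof. by rewrite /RLint set_itv1 Rintegral_set1 mulr0. Qed.

Lemma RLint_comp01 a b (c : R) g t : 0 < a -> 0 < b -> a + b = c ->
  t \in `[0, 1] -> cont 1 g -> RLint a (RLint b g) t = RLint c g t.
Proof.
move=> a0 b0 <-; rewrite in_itv/= => /andP[t0 t1] cg.
exact: RLint_comp a0 b0 t0 (contS t1 cg).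
Qed.

(** Writing I^a = I^1 I^(a-1) leaves only an outer I^1 to differentiate, so the kernel is never
    differentiated. *)
Lemma is01_RLint a b g t : 1 < a -> a - 1 = b -> cont 1 g -> t \in `[0, 1] ->
  is01 (RLint a g) t (RLint b g t).
Proof.
move=> a1 ab cg t01; have b0 : 0 < b by rewrite -ab subr_gt0.
have E : 1 + b = a by rewrite -ab; ring.
apply: (@eq_is01 (RLint 1 (RLint b g))) => //.
  by move=> s s01; exact: RLint_comp01 ltr01 b0 E s01 cg.
by apply: is01_RLint1 t01; exact: cont_RLint.
Qed.

Lemma is01_unique g t l l' : t \in `[0, 1] -> is01 g t l -> is01 g t l' -> l = l'.
Proof. by move=> t01 H1 H2; rewrite -(is01_deriv t01 H1) (is01_deriv t01 H2). Qed.

(** Powers are multiples of fractional integrals of the constant 1, which gives the derivative at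
    the endpoint 0 as well. *)
Lemma is01_powR a t : 0 < a -> t \in `[0, 1] ->
  is01 (fun s => s `^ (a + 1)) t (Gamma (a + 2) / Gamma (a + 1) * t `^ a).
Proof.
move=> a0 t01; have a1 : 1 < a + 1 by rewrite ltrDr.
have G1 := @Gamma_gt0 R (a + 1) ltac:(lra).
have G2 := @Gamma_gt0 R (a + 2) ltac:(lra).
have := @is01Z (Gamma (a + 2)) _ _ _ (is01_RLint a1 (addrK 1 a) (@cont_cst R 1 1) t01).
have := t01; rewrite in_itv/= => /andP[t0 t1].
rewrite (RLint_cst _ a0 t0) mul1r [_ * (_ / _)]mulrCA [X in is01 _ _ X]mulrC.
apply: eq_is01 => // s; rewrite in_itv/= => /andP[s0 s1].
have a10 : 0 < a + 1 by rewrite addr_gt0.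
rewrite (RLint_cst _ a10 s0).
have -> : a + 1 + 1 = a + 2 by ring.
by field; rewrite gt_eqF.
Qed.

(* Both sides appear in the derivative of s `^ (a + 1) at 1, computed once by the
   semigroup law and once by the power rule. *)
Lemma GammaS a : 0 < a -> Gamma (a + 2) = (a + 1) * Gamma (a + 1) :> R.
Proof.
move=> a0.
have G1 := @Gamma_gt0 R (a + 1) ltac:(lra).
have H1 := @is01_powR a 1 a0 ltac:(by rewrite in_itv/= ler01 lexx).
have H2 := is_derive_is01 (is_derive1_powR (a + 1) (@ltr01 R)).
have := is01_unique _ H1 H2; rewrite !powR1 !mulr1.
by rewrite in_itv/= ler01 lexx => /(_ isT) /(canRL (divfK (lt0r_neq0 G1))).
Qed.

End Derivatives01.

(** * Inverting Caputo derivatives *)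

Section Caputo.

Context {R : realType}.
Implicit Types (a s t T M l alpha beta : R) (g h x u v F D : R -> R).

Lemma truncn_nat_eq (n : nat) a : n%:R <= a < n.+1%:R -> Num.truncn a = n.
Proof. by move=> H; apply: truncn_def. Qed.

Lemma notin_nat (n : nat) a : n%:R < a < n.+1%:R -> (a \is a Num.nat) = false.
Proof.
move=> /andP[na an]; apply/negP => /natrP[m am].
by move: na an; rewrite am !ltr_nat ltnS => nm; rewrite leqNgt nm.
Qed.

(** Applying I^(1-a) yields equal first integrals, which are then differentiated. *)
Lemma RLint_inj a g h : 0 < a <= 1 -> cont 1 g -> cont 1 h ->
  (forall s : R, s \in `[0, 1] -> RLint a g s = RLint a h s) ->
  forall s : R, s \in `[0, 1] -> g s = h s.
Proof.
move=> /andP[a0 a1] cg ch gh.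
suff E : forall s : R, s \in `[0, 1] -> RLint 1 g s = RLint 1 h s.
  move=> t t01; apply: (is01_unique t01) (is01_RLint1 ch t01).
  by apply: eq_is01 (is01_RLint1 cg t01).
move: a1; rewrite le_eqVlt => /predU1P[a1|a1]; first by subst a.
move=> t t01; have E k : cont 1 k -> RLint 1 k t = RLint (1 - a) (RLint a k) t.
  move=> ck; have b0 : 0 < 1 - a by rewrite subr_gt0.
  exact/esym/(RLint_comp01 b0 a0 (subrK a 1) t01 ck).
rewrite (E _ cg) (E _ ch); apply: eq_RLint => s; rewrite in_itv/= => /andP[s0 st].
move: t01; rewrite in_itv/= => /andP[t0 t1].
by apply: gh; rewrite in_itv/= s0 (le_trans st).
Qed.

(** For alpha < 1, x - x(0) = I^1 u, so the primitive is I^(1-alpha) I^1 u = I^(2-alpha) u, with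
    derivative D = I^(1-alpha) u; applying I^alpha to D returns I^1 u. For alpha = 1, D = u. *)
Lemma caputo_le1 alpha x u : 0 < alpha <= 1 -> cont 1 u ->
  (forall t, t \in `[0, 1] -> is01 x t (u t)) ->
  exists D : R -> R, [/\ cont 1 D,
    forall s : R, s \in `[0, 1] -> caputo alpha x s = D s,
    caputo_derivable alpha x &
    forall t, t \in `[0, 1] -> RLint alpha D t = x t - x 0].
Proof.
move=> /andP[a0]; rewrite le_eqVlt => /predU1P[->|a1] cu dx.
  exists u; split => //.
  - move=> t t01; rewrite /caputo rpred1 truncn1 /=.
    exact: is01_deriv (dx t t01).
  - rewrite /caputo_derivable rpred1 truncn1 => -[|//] _ t /(itv_oo_cc (lexx 1)) t01.
    exact: is01_derivable (dx t t01).
  - exact: RLint1_deriv.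
have nat_a : (alpha \is a Num.nat) = false by apply: (@notin_nat 0); rewrite a0.
have tr_a : Num.truncn alpha = 0%N by apply: truncn_nat_eq; rewrite a1 ltW.
have b0 : 0 < 1 - alpha by rewrite subr_gt0.
have cx : cont 1 x by apply: cont_C1 dx.
have E : forall s : R, s \in `[0, 1] -> RLint (2 - alpha) u s = caputo_primitive alpha x s.
  move=> t t01; have := t01; rewrite in_itv/= => /andP[t0 t1].
  rewrite /caputo_primitive tr_a /=.
  have E2 : 1 - alpha + 1 = 2 - alpha by ring.
  rewrite -(RLint_comp01 b0 ltr01 E2 t01 cu).
  apply: eq_RLint => s; rewrite in_itv/= => /andP[s0 st].
  by rewrite (RLint1_deriv cu dx)// in_itv/= s0 (le_trans st).
have dP t : t \in `[0, 1] -> is01 (caputo_primitive alpha x) t (RLint (1 - alpha) u t).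
  move=> t01; apply: (eq_is01 t01 E).
  by apply: is01_RLint cu t01; [lra|ring].
exists (RLint (1 - alpha) u); split.
- exact: cont_RLint.
- by move=> t t01; rewrite /caputo nat_a; exact: is01_deriv (dP t t01).
- rewrite /caputo_derivable nat_a tr_a; split.
    case=> [|//] _; split => //=.
    by apply: continuous_subspaceW cx; exact: subset_itv_co_cc.
  by move=> t /(itv_oo_cc (lexx 1)) /dP /is01_derivable.
- move=> t t01; rewrite (RLint_comp01 a0 b0 _ t01 cu (c := 1)); last by ring.
  exact: RLint1_deriv cu dx t t01.
Qed.

(** Unlike [is01_eq0_cst], this assumes no continuity at the endpoints, where the derivatives of
    [langevin alpha gamma x] are not controlled. *)
Lemma is01_eq0_oo g : (forall t, t \in `]0, 1[ -> is01 g t 0) ->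
  forall s t, s \in `]0, 1[ -> t \in `]0, 1[ -> g s = g t.
Proof.
move=> dg.
suff H s t : s <= t -> s \in `]0, 1[ -> t \in `]0, 1[ -> g s = g t.
  by move=> s t s01 t01; case: (leP s t) => [|/ltW] st; [|symmetry]; exact: H.
move=> st; rewrite !in_itv/= => /andP[s0 s1] /andP[t0 t1].
have D (y : R) : y \in `[s, t] -> is_derive y 1 g 0.
  rewrite in_itv/= => /andP[sy yt].
  have y01 : y \in `]0, 1[ by rewrite in_itv/=; apply/andP; split; lra.
  by apply: is01_is_derive => //; exact: dg.
have D' (y : R) : y \in `]s, t[ -> is_derive y 1 g 0.
  by move=> yst; apply: D; exact: (subset_itv_oo_cc yst).
have cg : {within `[s, t], continuous g}.
  by apply: derivable_within_continuous => y /D[].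
have [c _] := MVT_segment st D' cg.
by rewrite mul0r => /eqP; rewrite subr_eq0 => /eqP.
Qed.

(** Two integrations, shared by integer and noninteger beta. The polynomials t and t^2/2 are written
    I^1 1 and I^2 1, ready for the semigroup law when I^alpha is applied. *)
Lemma quadratic_plus_RLint beta F h h1 h2 (c : R) : 2 < beta ->
  cont 1 F -> cont 1 h ->
  (forall t, t \in `]0, 1[ -> is01 h t (h1 t)) ->
  (forall t, t \in `]0, 1[ -> is01 h1 t (h2 t)) ->
  (forall t, t \in `]0, 1[ -> h2 t = RLint (beta - 2) F t + c) ->
  exists c0 c1, forall t, t \in `[0, 1] ->
    h t = c0 + c1 * RLint 1 (fun=> 1) t + c * RLint 2 (fun=> 1) t + RLint beta F t.
Proof.
move=> b2 cF ch dh dh1 h2E.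
have c1 : cont 1 (fun=> 1 : R) by exact: cont_cst.
have cc r : cont 1 (fun=> r : R) by exact: cont_cst.
have dI2 t : t \in `[0, 1] -> is01 (RLint 2 (fun=> 1)) t (RLint 1 (fun=> 1) t).
  by move=> t01; apply: is01_RLint t01; [lra|ring|exact: cont_cst].
have dI1 t : t \in `[0, 1] -> is01 (RLint 1 (fun=> 1)) t 1.
  by move=> t01; exact: (is01_RLint1 c1 t01).
have dF1 t : t \in `[0, 1] -> is01 (RLint (beta - 1) F) t (RLint (beta - 2) F t).
  by move=> t01; apply: is01_RLint cF t01; [lra|ring].
have dF t : t \in `[0, 1] -> is01 (RLint beta F) t (RLint (beta - 1) F t).
  by move=> t01; apply: is01_RLint cF t01; [lra|ring].
pose z1 t := h1 t - RLint (beta - 1) F t - c * RLint 1 (fun=> 1) t.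
have z1c s t : s \in `]0, 1[ -> t \in `]0, 1[ -> z1 s = z1 t.
  apply: is01_eq0_oo => {s}t t01; have t01' := itv_oo_cc (lexx 1) t01.
  have -> : 0 = h2 t - RLint (beta - 2) F t - c * 1.
    by rewrite h2E//; ring.
  apply: is01B; first by apply: is01B; [exact: dh1|exact: dF1].
  by apply: is01Z; exact: dI1.
(* The constant value of [z1], read at an interior point since nothing is assumed on [h1] at 0. *)
pose k := z1 2^-1.
pose z t := h t - RLint beta F t - c * RLint 2 (fun=> 1) t - k * RLint 1 (fun=> 1) t.
exists (z 0), k => t t01.
have <- : z t = z 0.
  apply: (is01_eq0_cst (lexx 1)) t01 => [|s s01].
    apply: contB; last by apply: contZ; exact: cont_RLint.
    apply: contB; last by apply: contZ; apply: cont_RLint.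
    by apply: contB => //; apply: cont_RLint => //; lra.
  have s01' := itv_oo_cc (lexx 1) s01.
  have -> : 0 = h1 s - RLint (beta - 1) F s - c * RLint 1 (fun=> 1) s - k * 1.
    have -> : k = z1 s by apply: z1c => //; rewrite in_itv/=; apply/andP; split; lra.
    by rewrite /z1; ring.
  apply: is01B; last by apply: is01Z; exact: dI1.
  apply: is01B; last by apply: is01Z; exact: dI2.
  by apply: is01B; [exact: dh|exact: dF].
rewrite /z; move: (RLint _ _ t) (RLint 1 _ t) (RLint 2 _ t) => I I1 I2.
by ring.
Qed.

(** For beta < 3, P = I^(3-beta) (h'' - h''(0)) vanishes at 0 and has derivative F, so P = I^1 F.
    Applying I^(beta-2) gives I^1 (h'' - h''(0)) = I^1 I^(beta-2) F, and differentiating recovers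
    h''. *)
Lemma caputo_inv beta F h : 2 < beta <= 3 -> cont 1 F -> cont 1 h ->
  caputo_derivable beta h ->
  (forall t, t \in `]0, 1[ -> caputo beta h t = F t) ->
  exists c0 c1 c2, forall t, t \in `[0, 1] ->
    h t = c0 + c1 * RLint 1 (fun=> 1) t + c2 * RLint 2 (fun=> 1) t + RLint beta F t.
Proof.
move=> /andP[b2]; rewrite le_eqVlt => /predU1P[b3|b3] cF ch.
  subst beta; rewrite /caputo_derivable /caputo.
  rewrite rpred_nat (truncn_nat_eq (n := 3)) ?lexx ?ltr_nat// => dh hF.
  (* For beta = 3 the derivatives of h are controlled on the open interval only, so the constant of
     integration is taken at 1/2 instead of 0. *)
  have h01 : (2^-1 : R) \in `]0, 1[.
    by rewrite in_itv/=; apply/andP; split; lra.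
  have E : forall t, t \in `]0, 1[ ->
      derivn01 2 h t = RLint (3 - 2) F t + (derivn01 2 h 2^-1 - RLint 1 F 2^-1).
    move=> t t01; have -> : 3 - 2 = 1 :> R by ring.
    apply/eqP; rewrite addrC -subr_eq; apply/eqP.
    apply: (@is01_eq0_oo (fun s => derivn01 2 h s - RLint 1 F s)) => // s s01.
    rewrite -(subrr (F s)); apply: is01B.
      by rewrite -{1}(hF s s01); apply: derivable01_is01; exact: dh.
    by apply: is01_RLint1 => //; exact: itv_oo_cc s01.
  have d0 t : t \in `]0, 1[ -> is01 h t (derivn01 1 h t) by exact: dh 0%N isT t.
  have d1 t : t \in `]0, 1[ -> is01 (derivn01 1 h) t (derivn01 2 h t).
    by exact: dh 1%N isT t.
  have [c0 [c1 H]] := quadratic_plus_RLint b2 cF ch d0 d1 E.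
  by exists c0, c1, (derivn01 2 h 2^-1 - RLint 1 F 2^-1).
have nat_b : (beta \is a Num.nat) = false by apply: (@notin_nat 2); rewrite b2.
have tr_b : Num.truncn beta = 2%N by apply: truncn_nat_eq; rewrite b3 ltW.
rewrite /caputo_derivable /caputo nat_b /caputo_primitive tr_b => -[Ch dP] hF.
set h2 := derivn01 2 h in Ch dP hF.
set P := RLint _ _ in dP hF.
have b30 : 0 < 3 - beta by rewrite subr_gt0.
have b20 : 0 < beta - 2 by rewrite subr_gt0.
have ch2 T : T < 1 -> cont T (fun s => h2 s - h2 0).
  move=> T1; apply: contB; last exact: cont_cst.
  apply: continuous_subspaceW (Ch 2%N (leqnn _)).1 => s /=.
  by rewrite !in_itv/= => /andP[-> /le_lt_trans]; exact.
have PE t : 0 <= t < 1 -> P t = RLint 1 F t.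
  move=> /andP[t0 t1].
  have cP : cont t P by apply: cont_RLint => //; exact: ch2.
  have c1F : cont t (RLint 1 F) by apply: cont_RLint => //; exact: contS (ltW t1) cF.
  have d0 s : s \in `]0, t[ -> is01 (fun s => P s - RLint 1 F s) s 0.
    move=> s0t; have s01 := itv_oo_cc (ltW t1) s0t.
    rewrite -(subrr (F s)); apply: is01B; last exact: is01_RLint1.
    have s01' : s \in `]0, 1[.
      by move: s0t; rewrite !in_itv/= => /andP[-> /lt_trans]; exact.
    by rewrite -(hF s s01'); apply: derivable01_is01; exact: dP.
  have tt : t \in `[0, t] by rewrite in_itv/= t0 lexx.
  have := is01_eq0_cst (ltW t1) (contB cP c1F) d0 tt.
  by rewrite /P !RLint_at0 subrr => /eqP; rewrite subr_eq0 => /eqP.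
have h2E t : t \in `]0, 1[ -> h2 t = RLint (beta - 2) F t + h2 0.
  rewrite in_itv/= => /andP[t0 t1].
  (* A point strictly between t and 1: h'' is continuous on [0, T], and clamping at T extends it to
     [0, 1] without changing it near t. *)
  pose T := (1 + t) / 2.
  have [T1 tT] : T < 1 /\ t < T by rewrite /T; split; lra.
  have T0 : 0 <= T by lra.
  have t0T : t \in `]0, T[ by rewrite in_itv/= t0.
  have t01 : t \in `[0, 1] by rewrite in_itv/= !ltW.
  pose g := (fun s => h2 s - h2 0) \o clamp T.
  have cg : cont 1 g by apply: continuous_subspaceT; apply: cont_clamp => //; exact: ch2.
  have gE s : s \in `[0, T] -> g s = h2 s - h2 0 by move=> sT; rewrite /g/= clampK.
  have cI : cont 1 (RLint (beta - 2) F) by exact: cont_RLint.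
  have IE : forall s : R, s \in `]0, T[ -> RLint 1 g s = RLint 1 (RLint (beta - 2) F) s.
    move=> s; rewrite in_itv/= => /andP[s0 sT].
    have s1 : s < 1 by lra.
    have s01 : s \in `[0, 1] by rewrite in_itv/= !ltW.
    rewrite (RLint_comp01 ltr01 b20 (c := beta - 1) _ s01 cF); last by ring.
    rewrite -(RLint_comp01 b20 ltr01 _ s01 cF); last by ring.
    rewrite (@eq_RLint _ (beta - 2) (RLint 1 F) P); last first.
      move=> r; rewrite in_itv/= => /andP[r0 rs].
      by rewrite PE// r0 (le_lt_trans rs).
    rewrite [RHS](RLint_comp b20 b30 (ltW s0) (ch2 _ s1)).
    have -> : beta - 2 + (3 - beta) = 1 by ring.
    apply: eq_RLint => r; rewrite in_itv/= => /andP[r0 rs].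
    by rewrite gE// in_itv/= r0 (le_trans rs)// ltW.
  have := is01_unique t01 (eq_is01_oo (ltW T1) t0T IE (is01_RLint1 cg t01))
    (is01_RLint1 cI t01).
  rewrite gE; first by move=> <-; rewrite subrK.
  by rewrite in_itv/= !ltW.
have d0 t : t \in `]0, 1[ -> is01 h t (derivn01 1 h t).
  rewrite in_itv/= => /andP[t0 t1].
  by apply: ((Ch 0%N isT).2 isT t); rewrite /= in_itv/= ltW.
have d1 t : t \in `]0, 1[ -> is01 (derivn01 1 h) t (h2 t).
  rewrite in_itv/= => /andP[t0 t1].
  by apply: ((Ch 1%N isT).2 isT t); rewrite /= in_itv/= ltW.
have [c0 [c1 H]] := quadratic_plus_RLint b2 cF ch d0 d1 h2E.
by exists c0, c1, (h2 0).
Qed.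

(** Two differentiations leave h'' = c2 + I^(beta-2) F, and for beta < 3, I^(3-beta) I^(beta-2) F =
    I^1 F has derivative F. No constant term occurs in h, since I^alpha would turn it into a
    multiple of t^alpha. *)
Lemma caputo_direct beta F h (c1 c2 : R) : 2 < beta <= 3 -> cont 1 F ->
  (forall t, t \in `[0, 1] ->
    h t = c1 * RLint 1 (fun=> 1) t + c2 * RLint 2 (fun=> 1) t + RLint beta F t) ->
  caputo_derivable beta h /\ (forall t, t \in `]0, 1[ -> caputo beta h t = F t).
Proof.
move=> /andP[b2 b3] cF hE.
have c1' : cont 1 (fun=> 1 : R) by exact: cont_cst.
have dI2 t : t \in `[0, 1] -> is01 (RLint 2 (fun=> 1)) t (RLint 1 (fun=> 1) t).
  by move=> t01; apply: is01_RLint t01; [lra|ring|exact: cont_cst].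
have dI1 t : t \in `[0, 1] -> is01 (RLint 1 (fun=> 1)) t 1.
  by move=> t01; exact: (is01_RLint1 c1' t01).
have dF1 t : t \in `[0, 1] -> is01 (RLint (beta - 1) F) t (RLint (beta - 2) F t).
  by move=> t01; apply: is01_RLint cF t01; [lra|ring].
have dF t : t \in `[0, 1] -> is01 (RLint beta F) t (RLint (beta - 1) F t).
  by move=> t01; apply: is01_RLint cF t01; [lra|ring].
pose h1 t := c1 + c2 * RLint 1 (fun=> 1) t + RLint (beta - 1) F t.
pose h2 t := c2 + RLint (beta - 2) F t.
have b20 : 0 < beta - 2 by rewrite subr_gt0.
have dh t : t \in `[0, 1] -> is01 h t (h1 t).
  move=> t01.
  apply: (@eq_is01 _ (fun t => c1 * RLint 1 (fun=> 1) t +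
    c2 * RLint 2 (fun=> 1) t + RLint beta F t)) => //.
    by move=> s /hE ->.
  have -> : h1 t = c1 * 1 + c2 * RLint 1 (fun=> 1) t + RLint (beta - 1) F t.
    by rewrite /h1 mulr1.
  apply: is01D; last exact: dF.
  by apply: is01D; apply: is01Z; [exact: dI1|exact: dI2].
have dE t : t \in `[0, 1] -> deriv01 h t = h1 t by move=> t01; exact: is01_deriv (dh t t01).
have dh1 t : t \in `[0, 1] -> is01 (deriv01 h) t (h2 t).
  move=> t01; apply: (@eq_is01 _ h1) => //; first by move=> s /dE.
  have -> : h2 t = 0 + c2 * 1 + RLint (beta - 2) F t by rewrite /h2 mulr1 add0r.
  apply: is01D; last exact: dF1.
  by apply: is01D; [exact: is01_cst|apply: is01Z; exact: dI1].
have dE2 t : t \in `[0, 1] -> deriv01 (deriv01 h) t = h2 t.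
  by move=> t01; exact: is01_deriv (dh1 t t01).
move: b3; rewrite le_eqVlt => /predU1P[b3|b3].
  subst beta.
  have dh2 t : t \in `[0, 1] -> is01 (deriv01 (deriv01 h)) t (F t).
    move=> t01; apply: (@eq_is01 _ h2) => //; first by move=> s /dE2.
    rewrite -[F t]add0r; apply: is01D; first exact: is01_cst.
    have -> : 3 - 2 = 1 :> R by ring.
    exact: is01_RLint1.
  rewrite /caputo_derivable /caputo.
  rewrite rpred_nat (truncn_nat_eq (n := 3)) ?lexx ?ltr_nat//; split.
    case=> [|[|[|//]]] _ t /(itv_oo_cc (lexx 1)) t01.
    - exact: is01_derivable (dh t t01).
    - exact: is01_derivable (dh1 t t01).
    - exact: is01_derivable (dh2 t t01).
  move=> t /(itv_oo_cc (lexx 1)) t01; exact: is01_deriv (dh2 t t01).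
have nat_b : (beta \is a Num.nat) = false by apply: (@notin_nat 2); rewrite b2.
have tr_b : Num.truncn beta = 2%N by apply: truncn_nat_eq; rewrite b3 ltW.
have PE : forall s : R, s \in `[0, 1] -> RLint 1 F s = caputo_primitive beta h s.
  move=> t t01; have := t01; rewrite in_itv/= => /andP[t0 t1].
  rewrite /caputo_primitive tr_b.
  have b30 : 0 < 3 - beta by rewrite subr_gt0.
  rewrite -(RLint_comp01 b30 b20 _ t01 cF); last by ring.
  apply: eq_RLint => s; rewrite in_itv/= => /andP[s0 st] /=.
  rewrite !dE2 ?in_itv/= ?lexx ?ler01// ?s0 ?(le_trans st)//.
  by rewrite /h2 RLint_at0; ring.
have dP t : t \in `[0, 1] -> is01 (caputo_primitive beta h) t (F t).
  by move=> t01; apply: (eq_is01 t01 PE); exact: is01_RLint1.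
have sub : `[0, 1[ `<=` (`[0, 1] : set R) by exact: subset_itv_co_cc.
rewrite /caputo_derivable /caputo nat_b tr_b; split.
  split; last by move=> t /(itv_oo_cc (lexx 1)) /dP /is01_derivable.
  case=> [|[|[|//]]] _; split.
  - apply: continuous_subspaceW sub _; exact: cont_C1 dh.
  - by move=> _ t /sub /dh /is01_derivable.
  - apply: continuous_subspaceW sub _; exact: cont_C1 dh1.
  - by move=> _ t /sub /dh1 /is01_derivable.
  - apply: continuous_subspaceW sub _.
    apply: (@eq_cont _ _ h2); first by move=> s /dE2.
    by apply: contD; [exact: cont_cst|exact: cont_RLint].
  - by [].
by move=> t /(itv_oo_cc (lexx 1)) t01; exact: is01_deriv (dP t t01).
Qed.

End Caputo.

(** * Picard iteration *)

Section Picard.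
Context {R : realType}.

Lemma geometric_small (q C e : R) : 0 <= q < 1 -> 0 < e ->
  exists n : nat, C * q ^+ n <= e.
Proof.
move=> /andP[q0 q1] e0.
have : C * q ^+ n @[n --> \oo] --> C * 0.
  by apply: cvgM; [exact: cvg_cst|apply: cvg_expr; rewrite ger0_norm].
rewrite mulr0 => /cvgrPdist_le/(_ e e0)[n _ /(_ n (leqnn n))].
rewrite sub0r normrN => H; exists n.
exact: le_trans (ler_norm _) H.
Qed.

Lemma le_geometric_eq0 (q C r : R) : 0 <= q < 1 ->
  (forall n : nat, `|r| <= C * q ^+ n) -> r = 0.
Proof.
move=> q01 H; apply/eqP; rewrite -normr_le0; apply/ler_addgt0Pr => e e0.
have [n Hn] := geometric_small C q01 e0.
by rewrite add0r (le_trans (H n)).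
Qed.

(** No normed space is built: being at distance at most m means |z j - z' j| <= om j * m for all j
    in D, and [P] plays the closed set on which T acts. Completeness is used pointwise, in R. *)
Context (J : Type) (D : J -> Prop) (om : J -> R).
Variables (P : (J -> R) -> Prop) (T : (J -> R) -> J -> R) (q : R).
Hypothesis q01 : 0 <= q < 1.
Hypothesis contractT : forall z z', P z -> P z' -> forall m : R, 0 <= m ->
  (forall j, D j -> `|z j - z' j| <= om j * m) ->
  forall j, D j -> `|T z j - T z' j| <= om j * (q * m).

Lemma picard_unique z z' (m : R) : P z -> P z' -> 0 <= m ->
  (forall j, D j -> `|z j - z' j| <= om j * m) ->
  (forall j, D j -> T z j = z j) -> (forall j, D j -> T z' j = z' j) ->
  forall j, D j -> z j = z' j.
Proof.
move=> Pz Pz' m0 zz' Tz Tz' j Dj; apply/eqP; rewrite -subr_eq0; apply/eqP.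
have q0 : 0 <= q by case/andP: q01.
apply: (@le_geometric_eq0 q (om j * m)) => // n.
suff : forall j, D j -> `|z j - z' j| <= om j * (q ^+ n * m).
  by move=> /(_ j Dj); rewrite [q ^+ n * m]mulrC mulrA.
elim: n => [|n IH] i Di; first by rewrite expr0 mul1r; exact: zz'.
rewrite -Tz// -Tz'// exprS -mulrA.
by apply: (contractT Pz Pz' _ IH Di); rewrite mulr_ge0 ?exprn_ge0.
Qed.

Hypothesis om0 : forall j, D j -> 0 <= om j.
Hypothesis PT : forall z, P z -> P (T z).
Hypothesis closedP : forall (z_ : nat -> J -> R) (z : J -> R), (forall n, P (z_ n)) ->
  (forall e : R, 0 < e -> exists n, forall j, D j -> `|z_ n j - z j| <= om j * e) -> P z.

Lemma picard_exists z0 (m : R) : P z0 -> 0 <= m ->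
  (forall j, D j -> `|T z0 j - z0 j| <= om j * m) ->
  exists2 z, P z & forall j, D j -> T z j = z j.
Proof.
move=> Pz0 m0 Tz0; have /andP[q0 q1] := q01.
pose z_ n := iter n T z0.
have Pz_ n : P (z_ n) by elim: n => [//|n IH]; rewrite /z_ iterS; exact: PT.
have step n j : D j -> `|z_ n.+1 j - z_ n j| <= om j * (q ^+ n * m).
  elim: n j => [|n IH] j Dj; first by rewrite expr0 mul1r; exact: Tz0.
  rewrite exprS -mulrA; apply: (contractT (Pz_ n.+1) (Pz_ n) _ IH Dj).
  by rewrite mulr_ge0 ?exprn_ge0.
(* K q^n is the sum of the remaining steps q^k m, k >= n. *)
pose K := m / (1 - q).
have K0 : 0 <= K by rewrite divr_ge0// subr_ge0 ltW.
have KE n j : om j * (q ^+ n * m) = om j * K * q ^+ n - om j * K * q ^+ n.+1.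
  rewrite exprS /K; field.
  by rewrite subr_eq0 gt_eqF.
(* The sequence [z_ n j] is squeezed between a nondecreasing and a nonincreasing
   sequence that are [2 om j K q ^ n] apart. *)
pose a n j := z_ n j - om j * K * q ^+ n.
pose b n j := z_ n j + om j * K * q ^+ n.
have and' n j : D j -> a n j <= a n.+1 j.
  by move=> /(step n); rewrite KE ler_norml /a => /andP[]; lra.
have bni n j : D j -> b n.+1 j <= b n j.
  by move=> /(step n); rewrite KE ler_norml /b => /andP[]; lra.
have ab n j : D j -> a n j <= b n j.
  move=> Dj; rewrite /a /b lerD2l ge0_cp//.
  by rewrite mulr_ge0 ?exprn_ge0// mulr_ge0// om0.
have abnk n k j : D j -> a n j <= a (n + k)%N j.
  move=> Dj; elim: k => [|k IH]; first by rewrite addn0.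
  by rewrite addnS (le_trans IH)// and'.
have bank n k j : D j -> b (n + k)%N j <= b n j.
  move=> Dj; elim: k => [|k IH]; first by rewrite addn0.
  by rewrite addnS (le_trans _ IH)// bni.
have aleb n k j : D j -> a n j <= b k j.
  move=> Dj; rewrite (le_trans (abnk n k j Dj))// (le_trans (ab _ _ Dj))//.
  by rewrite addnC bank.
pose z j := sup (range (a ^~ j)).
have az n j : D j -> a n j <= z j.
  move=> Dj; apply: ub_le_sup; last by exists n.
  by exists (b 0%N j) => _ [k _ <-]; exact: aleb.
have zb n j : D j -> z j <= b n j.
  move=> Dj; apply: ge_sup; first by exists (a 0%N j), 0%N.
  by move=> _ [k _ <-]; exact: aleb.
have dist n j : D j -> `|z_ n j - z j| <= om j * (K * q ^+ n).
  move=> Dj; rewrite mulrA; have := az n j Dj; have := zb n j Dj.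
  by rewrite /a /b ler_norml => H1 H2; apply/andP; split; lra.
have Pz : P z.
  apply: (closedP Pz_) => e e0.
  have [n Hn] := geometric_small K q01 e0.
  exists n => j Dj; rewrite (le_trans (dist n j Dj))//.
  by rewrite ler_wpM2l ?om0.
exists z => // j Dj; apply/eqP; rewrite -subr_eq0; apply/eqP.
apply: (@le_geometric_eq0 q (2 * (om j * K * q))) => // n.
(* T z is compared with T z_n = z_(n+1); this and the distance from z_(n+1) to z each contribute om
   j K q^(n+1), whence the factor 2. *)
have H1 : `|T z j - T (z_ n) j| <= om j * (q * (K * q ^+ n)).
  apply: contractT => //; first by rewrite mulr_ge0// exprn_ge0.
  by move=> i Di; rewrite distrC; exact: dist.
have H2 := dist n.+1 j Dj.
have E : T z j - z j = (T z j - T (z_ n) j) + (z_ n.+1 j - z j).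
  by rewrite /z_ iterS; ring.
rewrite E (le_trans (ler_normD _ _))// (le_trans (lerD H1 H2))// exprS.
by rewrite le_eqVlt; apply/orP; left; apply/eqP; ring.
Qed.

End Picard.

(** * The integral operator and its derivative *)

Lemma cont_rhs {R : realType} (f : R -> R -> R -> R) (x u : R -> R) :
  {within [set p : R * R * R | p.1.1 \in `[0, 1]],
    continuous (fun p : R * R * R => f p.1.1 p.1.2 p.2)} ->
  cont 1 x -> cont 1 u -> cont 1 (fun t => f t (x t) (u t)).
Proof.
move=> cf /contP cx /contP cu.
apply/subspace_continuousP => t t01.
have /subspace_continuousP Hf := cf.
apply: (@cvg_comp _ _ _ (fun s => (s, x s, u s))
  (fun p : R * R * R => f p.1.1 p.1.2 p.2) _
  (within [set p : R * R * R | p.1.1 \in `[0, 1]] (nbhs (t, x t, u t))));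
  last exact: Hf.
move=> Q /nbhs_ballP[e /= e0 eQ].
have e20 : 0 < e / 2 by rewrite divr_gt0.
have e2e : e / 2 < e by rewrite ltr_pdivrMr// ltr_pMr// ltr1n.
have [dx dx0 dxP] := cx t t01 _ e20.
have [du du0 duP] := cu t t01 _ e20.
apply/nbhs_ballP; exists (Num.min e (Num.min dx du)); first by rewrite /= !lt_min e0 dx0.
move=> s; rewrite /ball/= !lt_min distrC => /and3P[se sx su] s01.
apply: eQ => //; split; first split; rewrite /ball/= distrC//.
- by rewrite (le_lt_trans (dxP _ s01 sx)).
- by rewrite (le_lt_trans (duP _ s01 su)).
Qed.

Section Operator.
Context {R : realType}.
Variables (alpha beta gamma : R).
Hypotheses (alpha0 : 0 < alpha) (alpha1 : alpha <= 1).
Hypotheses (beta2 : 2 < beta) (beta3 : beta <= 3).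
Implicit Types (s t : R) (x u y v F : R -> R).

Local Ltac slra := move: alpha0 alpha1 beta2 beta3 => ? ? ? ?; lra.

Definition sol0 F x (d1 d2 : R) t : R :=
  RLint (alpha + beta) F t - gamma * RLint alpha x t
  + d1 * t `^ (alpha + 1) + d2 * t `^ (alpha + 2).

(** The derivative of [sol0 F x d1 d2] when x = I^1 u. Its middle term is I^alpha u because I^alpha
    x = I^(alpha+1) u. *)
Definition sol1 F u (d1 d2 : R) t : R :=
  RLint (alpha + beta - 1) F t - gamma * RLint alpha u t
  + d1 * ((alpha + 1) * t `^ alpha) + d2 * ((alpha + 2) * t `^ (alpha + 1)).

Lemma cont_powR (a : R) : 0 < a -> cont 1 (fun t => t `^ a).
Proof.
move=> a0; apply: (@eq_cont _ _ (fun t => Gamma (a + 1) * RLint a (fun=> 1) t)).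
  move=> t; rewrite in_itv/= => /andP[t0 _].
  by rewrite RLint_cst// mul1r mulrC divfK// gt_eqF// Gamma_gt0// addr_gt0.
by apply: contZ; apply: cont_RLint => //; exact: cont_cst.
Qed.

Lemma cont_sol0 F x d1 d2 : cont 1 F -> cont 1 x -> cont 1 (sol0 F x d1 d2).
Proof.
move=> cF cx; apply: contD; last by apply: contZ; apply: cont_powR; slra.
apply: contD; last by apply: contZ; apply: cont_powR; slra.
by apply: contB; [|apply: contZ]; apply: cont_RLint => //; slra.
Qed.

Lemma cont_sol1 F u d1 d2 : cont 1 F -> cont 1 u -> cont 1 (sol1 F u d1 d2).
Proof.
move=> cF cu; apply: contD; last by do 2 apply: contZ; apply: cont_powR; slra.
apply: contD; last by do 2 apply: contZ; apply: cont_powR; slra.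
by apply: contB; [|apply: contZ]; apply: cont_RLint => //; slra.
Qed.

Lemma is01_powRS (a t : R) : 0 < a -> t \in `[0, 1] ->
  is01 (fun s => s `^ (a + 1)) t ((a + 1) * t `^ a).
Proof.
move=> a0 t01; have := is01_powR a0 t01.
by rewrite GammaS// mulfK// gt_eqF// Gamma_gt0// addr_gt0.
Qed.

Lemma is01_sol0 F x u d1 d2 t : cont 1 F -> cont 1 u ->
  (forall s : R, s \in `[0, 1] -> x s = RLint 1 u s) -> t \in `[0, 1] ->
  is01 (sol0 F x d1 d2) t (sol1 F u d1 d2 t).
Proof.
move=> cF cu xu t01.
have dx : is01 (RLint alpha x) t (RLint alpha u t).
  apply: (@eq_is01 _ (RLint (alpha + 1) u)) => //.
    move=> s s01; have := s01; rewrite in_itv/= => /andP[s0 s1].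
    rewrite -(RLint_comp01 alpha0 ltr01 erefl s01 cu).
    apply: eq_RLint => r; rewrite in_itv/= => /andP[r0 rs].
    by rewrite xu// in_itv/= r0 (le_trans rs).
  by apply: is01_RLint cu t01; [slra|ring].
apply: is01D; last first.
  apply: is01Z; have -> : alpha + 2 = alpha + 1 + 1 by ring.
  by apply: is01_powRS => //; slra.
apply: is01D; last by apply: is01Z; exact: is01_powRS.
by apply: is01B; [apply: is01_RLint cF t01; [slra|ring]|exact: is01Z].
Qed.

Definition bcoef1 F x u : R :=
  sol1 F u 0 0 1 - (alpha + 2) * sol0 F x 0 0 1.

Definition bcoef2 F x u : R :=
  (alpha + 1) * sol0 F x 0 0 1 - sol1 F u 0 0 1.

Lemma sol0_split F x d1 d2 t : sol0 F x d1 d2 t =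
  sol0 F x 0 0 t + d1 * t `^ (alpha + 1) + d2 * t `^ (alpha + 2).
Proof. by rewrite /sol0; ring. Qed.

Lemma sol1_split F u d1 d2 t : sol1 F u d1 d2 t =
  sol1 F u 0 0 t + d1 * ((alpha + 1) * t `^ alpha)
  + d2 * ((alpha + 2) * t `^ (alpha + 1)).
Proof. by rewrite /sol1; ring. Qed.

(* The boundary conditions at 1 are a linear system with determinant 1 in the
   coefficients. *)
Lemma bcoefP F x u d1 d2 :
  (sol0 F x d1 d2 1 = 0 /\ sol1 F u d1 d2 1 = 0) <->
  (d1 = bcoef1 F x u /\ d2 = bcoef2 F x u).
Proof.
rewrite sol0_split sol1_split /bcoef1 /bcoef2 !powR1.
set A := sol0 _ _ _ _ _; set B := sol1 _ _ _ _ _.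
split=> [[H0 H1]|[-> ->]]; last by split; ring.
split; apply/eqP; rewrite -subr_eq0; apply/eqP.
  rewrite -[RHS](_ : (alpha + 2) * (A + d1 * 1 + d2 * 1) -
    (B + d1 * ((alpha + 1) * 1) + d2 * ((alpha + 2) * 1)) = 0); first by ring.
  by rewrite H0 H1; ring.
rewrite -[RHS](_ : (B + d1 * ((alpha + 1) * 1) + d2 * ((alpha + 2) * 1)) -
  (alpha + 1) * (A + d1 * 1 + d2 * 1) = 0); first by ring.
by rewrite H0 H1; ring.
Qed.

Lemma powR_le1 (a t : R) : 0 <= a -> 0 <= t <= 1 -> 0 <= t `^ a <= 1.
Proof.
move=> a0 /andP[t0 t1]; rewrite powR_ge0/=.
rewrite -[leRHS](_ : 1 `^ a = 1); last by rewrite powR1.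
by rewrite ge0_ler_powR ?nnegrE.
Qed.

Lemma RLint_le1 (a M : R) g t : 0 < a -> t \in `[0, 1] -> cont 1 g -> 0 <= M ->
  (forall s, s \in `[0, 1] -> `|g s| <= M) ->
  `|RLint a g t| <= M / Gamma (a + 1).
Proof.
move=> a0; rewrite in_itv/= => /andP[t0 t1] cg M0 gM.
have G0 : 0 < Gamma (a + 1) by rewrite Gamma_gt0// addr_gt0.
apply: (le_trans (RLint_le a0 t0 (contS t1 cg) (M := M) _)).
  move=> s; rewrite in_itv/= => /andP[s0 st]; apply: gM.
  by rewrite in_itv/= s0 (le_trans st).
rewrite ler_wpM2l// ler_pdivrMr// mulVf ?gt_eqF//.
by have /andP[] : 0 <= t `^ a <= 1 by apply: powR_le1; rewrite ?t0// ltW.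
Qed.

Lemma norm_comb_le (X c c' r r' : R) : 0 <= r <= 1 -> 0 <= r' <= 1 ->
  `|X + c * r + c' * r'| <= `|X| + `|c| + `|c'|.
Proof.
move=> /andP[r0 r1] /andP[r'0 r'1].
rewrite (le_trans (ler_normD _ _))// lerD//.
  rewrite (le_trans (ler_normD _ _))// lerD// normrM (ger0_norm r0).
  by rewrite ler_piMr.
by rewrite normrM (ger0_norm r'0) ler_piMr.
Qed.

(** * Contraction estimates *)

Section Contraction.
Variables (w : R) (f : R -> R -> R -> R).
Hypothesis w0 : 0 < w.
Hypothesis cf : {within [set p : R * R * R | p.1.1 \in `[0, 1]],
    continuous (fun p : R * R * R => f p.1.1 p.1.2 p.2)}.
Hypothesis lipf : forall t x y u v : R, t \in `[0, 1] ->
    `|f t x y - f t u v| <= w * (`|x - u| + `|y - v|).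
Variables (x u y v : R -> R) (N0 N1 : R).
Hypotheses (cx : cont 1 x) (cu : cont 1 u) (cy : cont 1 y) (cv : cont 1 v).
Hypothesis xy : forall s, s \in `[0, 1] -> `|x s - y s| <= N0.
Hypothesis uv : forall s, s \in `[0, 1] -> `|u s - v s| <= N1.
Let Fx t := f t (x t) (u t).
Let Fy t := f t (y t) (v t).
Let W := w * (N0 + N1) / Gamma (alpha + beta + 1).
Let V := `|gamma| / Gamma (alpha + 1).

Let N00 : 0 <= N0.
Proof. by apply: le_trans (xy (s := 0) _); rewrite ?normr_ge0// in_itv/= lexx ler01. Qed.

Let N10 : 0 <= N1.
Proof. by apply: le_trans (uv (s := 0) _); rewrite ?normr_ge0// in_itv/= lexx ler01. Qed.

Let FxFy s : s \in `[0, 1] -> `|Fx s - Fy s| <= w * (N0 + N1).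
Proof.
move=> s01; rewrite (le_trans (lipf _ _ _ _ s01))// ler_wpM2l ?(ltW w0)//.
by rewrite lerD ?xy ?uv.
Qed.

Let cFx : cont 1 Fx. Proof. exact: cont_rhs. Qed.
Let cFy : cont 1 Fy. Proof. exact: cont_rhs. Qed.

Let gammaRL (g h : R -> R) N t : cont 1 g -> cont 1 h -> 0 <= N -> t \in `[0, 1] ->
  (forall s, s \in `[0, 1] -> `|g s - h s| <= N) ->
  `|gamma * (RLint alpha g t - RLint alpha h t)| <= V * N.
Proof.
move=> cg ch n0 t01 gh; rewrite normrM /V mulrAC -mulrA ler_wpM2l//.
have t1 : t <= 1 by move: t01; rewrite in_itv/= => /andP[].
rewrite -(RLintB alpha0 (contS t1 cg) (contS t1 ch)).
by apply: (RLint_le1 alpha0 t01 (contB cg ch) n0 gh).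
Qed.

Lemma sol0_dist t : t \in `[0, 1] ->
  `|sol0 Fx x 0 0 t - sol0 Fy y 0 0 t| <= W + V * N0.
Proof.
move=> t01; have t1 : t <= 1 by move: t01; rewrite in_itv/= => /andP[].
rewrite (_ : _ - _ = (RLint (alpha + beta) Fx t - RLint (alpha + beta) Fy t)
  - gamma * (RLint alpha x t - RLint alpha y t)); last by rewrite /sol0; ring.
rewrite (le_trans (ler_normB _ _))// lerD//; last exact: gammaRL.
have p0 : 0 < alpha + beta by slra.
have W0 : 0 <= w * (N0 + N1) by rewrite mulr_ge0 ?(ltW w0)// addr_ge0.
rewrite -(RLintB p0 (contS t1 cFx) (contS t1 cFy)).
exact: RLint_le1 p0 t01 (contB cFx cFy) W0 FxFy.
Qed.

(** The 4 bounds alpha + beta in Gamma(alpha+beta+1) = (alpha+beta) Gamma(alpha+beta), which brings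
    the integral of order alpha + beta - 1 to the denominator of [W]. *)
Lemma sol1_dist t : t \in `[0, 1] ->
  `|sol1 Fx u 0 0 t - sol1 Fy v 0 0 t| <= 4 * W + V * N1.
Proof.
move=> t01; have t1 : t <= 1 by move: t01; rewrite in_itv/= => /andP[].
rewrite (_ : _ - _ = (RLint (alpha + beta - 1) Fx t - RLint (alpha + beta - 1) Fy t)
  - gamma * (RLint alpha u t - RLint alpha v t)); last by rewrite /sol1; ring.
rewrite (le_trans (ler_normB _ _))// lerD//; last exact: gammaRL.
have p1 : 0 < alpha + beta - 1 by slra.
have W0 : 0 <= w * (N0 + N1) by rewrite mulr_ge0 ?(ltW w0)// addr_ge0.
rewrite -(RLintB p1 (contS t1 cFx) (contS t1 cFy)).
apply: (@le_trans _ _ (w * (N0 + N1) / Gamma (alpha + beta - 1 + 1))).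
  exact: RLint_le1 p1 t01 (contB cFx cFy) W0 FxFy.
have G1 : 0 < Gamma (alpha + beta - 1 + 1) by rewrite Gamma_gt0//; slra.
rewrite /W; have -> : alpha + beta + 1 = alpha + beta - 1 + 2 by ring.
rewrite GammaS//; set X := w * _ in W0 *; set G := Gamma _ in G1 *.
have q0 : 0 < alpha + beta - 1 + 1 by slra.
have q4 : alpha + beta - 1 + 1 <= 4 by slra.
move: (alpha + beta - 1 + 1) q0 q4 => r r0 r4.
have -> : 4 * (X / (r * G)) = (4 / r) * (X / G) by field; rewrite !gt_eqF.
rewrite ler_peMl ?divr_ge0 ?(ltW G1)//.
by rewrite ler_pdivlMr// mul1r.
Qed.

Let A := sol0 Fx x 0 0 1 - sol0 Fy y 0 0 1.
Let B := sol1 Fx u 0 0 1 - sol1 Fy v 0 0 1.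

Let one01 : (1 : R) \in `[0, 1]. Proof. by rewrite in_itv/= ler01 lexx. Qed.

(** 7 = 4 + 3: the bound on B plus alpha + 2 <= 3 times the bound on A. For [bcoef2], alpha + 1 <= 2
    gives 6 = 4 + 2. *)
Let bcoef1_dist : `|bcoef1 Fx x u - bcoef1 Fy y v| <= 7 * W + 3 * (V * N0) + V * N1.
Proof.
rewrite (_ : _ - _ = B - (alpha + 2) * A); last by rewrite /bcoef1 /A /B; ring.
have HA := sol0_dist one01; have HB := sol1_dist one01.
rewrite (le_trans (ler_normB _ _))// normrM [`|alpha + 2|]ger0_norm; last slra.
have : (alpha + 2) * `|A| <= 3 * `|A| by rewrite ler_wpM2r//; slra.
rewrite -/A in HA; rewrite -/B in HB; slra.
Qed.

Let bcoef2_dist : `|bcoef2 Fx x u - bcoef2 Fy y v| <= 6 * W + 2 * (V * N0) + V * N1.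
Proof.
rewrite (_ : _ - _ = (alpha + 1) * A - B); last by rewrite /bcoef2 /A /B; ring.
have HA := sol0_dist one01; have HB := sol1_dist one01.
rewrite (le_trans (ler_normB _ _))// normrM [`|alpha + 1|]ger0_norm; last slra.
have : (alpha + 1) * `|A| <= 2 * `|A| by rewrite ler_wpM2r//; slra.
rewrite -/A in HA; rewrite -/B in HB; slra.
Qed.

Let V0 : 0 <= V.
Proof. by rewrite divr_ge0// ltW// Gamma_gt0//; slra. Qed.

(** 14 = 1 + 7 + 6. The terms in V add up to 6 N0 + 2 N1, which is at most 8 (N0 + N1). *)
Lemma sol0_contract t : t \in `[0, 1] ->
  `|sol0 Fx x (bcoef1 Fx x u) (bcoef2 Fx x u) t -
    sol0 Fy y (bcoef1 Fy y v) (bcoef2 Fy y v) t| <=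
  (14 * w / Gamma (alpha + beta + 1) + 8 * V) * (N0 + N1).
Proof.
move=> t01; have t01' : 0 <= t <= 1 by move: t01; rewrite in_itv/=.
rewrite sol0_split (sol0_split Fy).
rewrite (_ : _ - _ = (sol0 Fx x 0 0 t - sol0 Fy y 0 0 t) +
  (bcoef1 Fx x u - bcoef1 Fy y v) * t `^ (alpha + 1) +
  (bcoef2 Fx x u - bcoef2 Fy y v) * t `^ (alpha + 2)); last by ring.
apply: le_trans (norm_comb_le _ _ _ _ _) _; [apply: powR_le1 => //; slra..|].
have H0 := sol0_dist t01; have H1 := bcoef1_dist; have H2 := bcoef2_dist.
have VN0 : 0 <= V * N0 by exact: mulr_ge0.
have VN1 : 0 <= V * N1 by exact: mulr_ge0.
apply: (@le_trans _ _ (14 * W + 6 * (V * N0) + 2 * (V * N1))); first slra.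
apply: (@le_trans _ _ (14 * W + 8 * (V * N0) + 8 * (V * N1))); first slra.
by rewrite le_eqVlt; apply/orP; left; apply/eqP; rewrite /W; ring.
Qed.

(** Differentiating the powers multiplies the coefficient bounds by 2 and 3, so 36 = 4 + 2*7 + 3*6.
    The terms in V add up to 12 N0 + 6 N1, at most 18 (N0 + N1). *)
Lemma sol1_contract t : t \in `[0, 1] ->
  `|sol1 Fx u (bcoef1 Fx x u) (bcoef2 Fx x u) t -
    sol1 Fy v (bcoef1 Fy y v) (bcoef2 Fy y v) t| <=
  (36 * w / Gamma (alpha + beta + 1) + 18 * V) * (N0 + N1).
Proof.
move=> t01; have t01' : 0 <= t <= 1 by move: t01; rewrite in_itv/=.
rewrite sol1_split (sol1_split Fy).
rewrite (_ : _ - _ = (sol1 Fx u 0 0 t - sol1 Fy v 0 0 t) +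
  ((alpha + 1) * (bcoef1 Fx x u - bcoef1 Fy y v)) * t `^ alpha +
  ((alpha + 2) * (bcoef2 Fx x u - bcoef2 Fy y v)) * t `^ (alpha + 1)); last by ring.
apply: le_trans (norm_comb_le _ _ _ _ _) _; [apply: powR_le1 => //; slra..|].
have H0 := sol1_dist t01; have H1 := bcoef1_dist; have H2 := bcoef2_dist.
have VN0 : 0 <= V * N0 by exact: mulr_ge0.
have VN1 : 0 <= V * N1 by exact: mulr_ge0.
rewrite !normrM [`|alpha + 1|]ger0_norm ?[`|alpha + 2|]ger0_norm; [|slra..].
have H1' : (alpha + 1) * `|bcoef1 Fx x u - bcoef1 Fy y v| <=
  2 * `|bcoef1 Fx x u - bcoef1 Fy y v| by rewrite ler_wpM2r//; slra.
have H2' : (alpha + 2) * `|bcoef2 Fx x u - bcoef2 Fy y v| <=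
  3 * `|bcoef2 Fx x u - bcoef2 Fy y v| by rewrite ler_wpM2r//; slra.
apply: (@le_trans _ _ (36 * W + 12 * (V * N0) + 6 * (V * N1))); first slra.
apply: (@le_trans _ _ (36 * W + 18 * (V * N0) + 18 * (V * N1))); first slra.
by rewrite le_eqVlt; apply/orP; left; apply/eqP; rewrite /W; ring.
Qed.

End Contraction.

End Operator.

(** * Solutions as fixed points *)

Opaque RLint Gamma.

Section FixedPoint.
Context {R : realType}.
Implicit Types (alpha beta gamma s t : R) (x u y v F D : R -> R).
Implicit Types (f : R -> R -> R -> R).

(** Applies I^alpha to the general solution of the outer equation. The Gamma denominators come from
    I^(alpha+k) 1 = t^(alpha+k) / Gamma(alpha+k+1). *)
Lemma RLint_langevin alpha beta gamma (c0 c1 c2 : R) F y t :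
  0 < alpha -> 2 < beta -> cont 1 F -> cont 1 y -> t \in `[0, 1] ->
  RLint alpha (fun s => c0 + c1 * RLint 1 (fun=> 1) s + c2 * RLint 2 (fun=> 1) s
    + RLint beta F s - gamma * y s) t =
  c0 / Gamma (alpha + 1) * t `^ alpha +
  sol0 alpha beta gamma F y (c1 / Gamma (alpha + 1 + 1)) (c2 / Gamma (alpha + 2 + 1)) t.
Proof.
move=> a0 b2 cF cy t01.
have := t01; rewrite in_itv/= => /andP[t0 t1].
have b0 : 0 < beta by exact: lt_trans b2.
have k1 : cont 1 (fun=> 1 : R) by exact: cont_cst.
have cc : cont t (fun=> c0) by exact: cont_cst.
have cI1 : cont 1 (RLint 1 (fun=> 1 : R)) by exact: cont_RLint.
have cI2 : cont 1 (RLint 2 (fun=> 1 : R)) by exact: cont_RLint.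
have cIF : cont 1 (RLint beta F) by exact: cont_RLint.
have cI1t := contZ (c := c1) (contS t1 cI1).
have cI2t := contZ (c := c2) (contS t1 cI2).
have cIFt := contS t1 cIF.
have cyt := contZ (c := gamma) (contS t1 cy).
have cA := contD cc cI1t.
have cB := contD cA cI2t.
have cC := contD cB cIFt.
rewrite (RLintB a0 cC cyt) (RLintD a0 cB cIFt) (RLintD a0 cA cI2t) (RLintD a0 cc cI1t).
rewrite (RLintZ _ a0 (contS t1 cI1)) (RLintZ _ a0 (contS t1 cI2)) (RLintZ _ a0 (contS t1 cy)).
rewrite (RLint_comp01 a0 ltr01 erefl t01 k1).
rewrite (RLint_comp01 a0 (ltr0n R 2) erefl t01 k1).
rewrite (RLint_comp01 a0 b0 erefl t01 cF).
have a10 : 0 < alpha + 1 by rewrite addr_gt0.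
have a20 : 0 < alpha + 2 by rewrite addr_gt0.
rewrite (RLint_cst _ a0 t0) (RLint_cst _ a10 t0) (RLint_cst _ a20 t0) /sol0.
move: (RLint _ F t) (RLint _ y t) (t `^ alpha) (t `^ (alpha + 1))
  (t `^ (alpha + 2)) (Gamma (alpha + 1))^-1 (Gamma (alpha + 1 + 1))^-1
  (Gamma (alpha + 2 + 1))^-1 => I J p p1 p2 g g1 g2.
by ring.
Qed.

(** The relation between x and [RLint 1 u] encodes x' = u together with x(0) = 0. *)
Definition fixpoint_bvp alpha beta gamma f x u : Prop :=
  let F := fun s => f s (x s) (u s) in
  let d1 := bcoef1 alpha beta gamma F x u in
  let d2 := bcoef2 alpha beta gamma F x u in
  [/\ cont 1 x, cont 1 u, forall s, s \in `[0, 1] -> x s = RLint 1 u s,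
    forall s, s \in `[0, 1] -> x s = sol0 alpha beta gamma F x d1 d2 s &
    forall s, s \in `[0, 1] -> u s = sol1 alpha beta gamma F u d1 d2 s].

Lemma sol1_at0 alpha beta gamma F u d1 d2 : 0 < alpha ->
  sol1 alpha beta gamma F u d1 d2 0 = 0.
Proof.
move=> a0; rewrite /sol1 !RLint_at0 !powR0 ?gt_eqF ?addr_gt0//.
by rewrite !mulr0 subrr !addr0.
Qed.

Lemma zero01 : (0 : R) \in `[0, 1]. Proof. by rewrite in_itv/= lexx ler01. Qed.

Lemma one01 : (1 : R) \in `[0, 1]. Proof. by rewrite in_itv/= lexx ler01. Qed.

Lemma fixpoint_solution alpha beta gamma f x u :
  0 < alpha <= 1 -> 2 < beta <= 3 ->
  {within [set p : R * R * R | p.1.1 \in `[0, 1]],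
    continuous (fun p : R * R * R => f p.1.1 p.1.2 p.2)} ->
  fixpoint_bvp alpha beta gamma f x u -> is_solution alpha beta gamma f x.
Proof.
move=> a01 b23 cf; have /andP[a0 a1] := a01; have /andP[b2 b3] := b23.
rewrite /fixpoint_bvp; set F := fun s => _.
set d1 := bcoef1 _ _ _ _ _ _; set d2 := bcoef2 _ _ _ _ _ _.
move=> [cx cu xu xE uE].
have cF : cont 1 F by exact: cont_rhs.
have dx t : t \in `[0, 1] -> is01 x t (u t).
  move=> t01; apply: (@eq_is01 _ (RLint 1 u)) => //; last exact: is01_RLint1.
  by move=> s s01; rewrite xu.
have dE t : t \in `[0, 1] -> deriv01 x t = u t by move=> t01; exact: is01_deriv (dx t t01).
have x0 : x 0 = 0 by rewrite xu ?zero01// RLint_at0.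
have [x1 u1] : sol0 alpha beta gamma F x d1 d2 1 = 0 /\ sol1 alpha beta gamma F u d1 d2 1 = 0.
  exact/bcoefP.
have [D [cD DE dera RD]] := caputo_le1 a01 cu dx.
(* Scaled so that the divisions in [RLint_langevin] give back d1 and d2; the leading 0 of [v] is the
   coefficient of t^alpha. *)
pose c1 := d1 * Gamma (alpha + 1 + 1).
pose c2 := d2 * Gamma (alpha + 2 + 1).
pose v t := 0 + c1 * RLint 1 (fun=> 1) t + c2 * RLint 2 (fun=> 1) t
  + RLint beta F t - gamma * x t.
have b0 : 0 < beta by exact: lt_trans b2.
have cv : cont 1 v.
  apply: contB; last exact: contZ.
  apply: contD; last exact: cont_RLint.
  apply: contD; last by apply: contZ; apply: cont_RLint => //; exact: cont_cst.
  apply: contD; first exact: cont_cst.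
  by apply: contZ; apply: cont_RLint => //; exact: cont_cst.
have G1 : 0 < Gamma (alpha + 1 + 1) by rewrite Gamma_gt0 ?addr_gt0.
have G2 : 0 < Gamma (alpha + 2 + 1) by rewrite Gamma_gt0 ?addr_gt0.
(* Both sides have fractional integral x of order alpha: D since x(0) = 0, and v by the fixed-point
   equation. *)
have Dv t : t \in `[0, 1] -> D t = v t.
  apply: (RLint_inj a01 cD cv) => s s01.
  rewrite (RD s s01) x0 subr0 /v (RLint_langevin _ _ _ _ a0 b2 cF cx s01).
  rewrite mul0r mul0r add0r (xE s s01) /c1 /c2.
  by rewrite (mulfK (lt0r_neq0 G1)) (mulfK (lt0r_neq0 G2)).
have hE t : t \in `[0, 1] -> langevin alpha gamma x t =
    c1 * RLint 1 (fun=> 1) t + c2 * RLint 2 (fun=> 1) t + RLint beta F t.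
  move=> t01; rewrite /langevin (DE t t01) (Dv t t01) /v.
  by rewrite subrK add0r.
have [derb Eb] := caputo_direct b23 cF hE.
split => //.
- case=> [|[|//]] _; split => //=.
  + by move=> _ t /dx /is01_derivable.
  + by apply: (@eq_cont _ _ u) => // s /dE.
- move=> t t01; rewrite (Eb t t01) /F dE//.
  exact: itv_oo_cc (lexx 1) t01.
- split => //; first by rewrite (xE _ one01).
    by rewrite (dE _ zero01) (uE _ zero01) sol1_at0.
  by rewrite (dE _ one01) (uE _ one01).
Qed.

(* As alpha <= 1, the function s `^ alpha has no zero one-sided derivative at 0. *)
Lemma is01_powR_eq0 alpha (c : R) : 0 < alpha <= 1 ->
  is01 (fun s => c * s `^ alpha) 0 0 -> c = 0.
Proof.
move=> /andP[a0 a1] /is01P H; apply/eqP; rewrite -normr_le0.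
apply/ler_addgt0Pr => e e0; rewrite add0r.
have [d d0 dP] := H e e0.
pose s := Num.min (d / 2) 1.
have s0 : 0 < s by rewrite lt_min ltr01 andbT divr_gt0.
have s1 : s <= 1 by rewrite ge_min lexx orbT.
have sd : s < d.
  by rewrite gt_min ltr_pdivrMr// ltr_pMr// ltr1n.
have := dP s; rewrite in_itv/= (ltW s0) s1 subr0 gtr0_norm// => /(_ isT sd).
rewrite powR0 ?gt_eqF// mulr0 mul0r !subr0 normrM (ger0_norm (powR_ge0 _ _)) => Hs.
rewrite -(ler_pM2r s0); apply: le_trans Hs.
rewrite ler_wpM2l//; apply: ger1_powR => //.
by rewrite s0 s1.
Qed.

Lemma solution_fixpoint alpha beta gamma f y :
  0 < alpha <= 1 -> 2 < beta <= 3 ->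
  {within [set p : R * R * R | p.1.1 \in `[0, 1]],
    continuous (fun p : R * R * R => f p.1.1 p.1.2 p.2)} ->
  is_solution alpha beta gamma f y ->
  fixpoint_bvp alpha beta gamma f y (deriv01 y).
Proof.
move=> a01 b23 cf [C1 [dera derb] yE [y0 y1 u0 u1]].
have /andP[a0 a1] := a01; have /andP[b2 b3] := b23.
rewrite /fixpoint_bvp; set F := fun s => _; set u := deriv01 y in u0 u1 F *.
set d1 := bcoef1 _ _ _ _ _ _; set d2 := bcoef2 _ _ _ _ _ _.
have [cy dy] := C1 0%N isT.
have [cu _] := C1 1%N isT.
have {dy}dy t : t \in `[0, 1] -> is01 y t (u t).
  by move=> t01; apply: derivable01_is01; exact: (dy isT).
have cF : cont 1 F by exact: cont_rhs.
have yu t : t \in `[0, 1] -> y t = RLint 1 u t.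
  by move=> t01; rewrite (RLint1_deriv cu dy t01) y0 subr0.
have [D [cD DE _ RD]] := caputo_le1 a01 cu dy.
have ch : cont 1 (langevin alpha gamma y).
  apply: (@eq_cont _ _ (fun t => D t + gamma * y t)).
    by move=> s s01; rewrite /langevin DE.
  by apply: contD => //; exact: contZ.
have yE' t : t \in `]0, 1[ -> caputo beta (langevin alpha gamma y) t = F t by exact: yE.
have [c0 [c1 [c2 hE]]] := caputo_inv b23 cF ch derb yE'.
pose e1 := c1 / Gamma (alpha + 1 + 1).
pose e2 := c2 / Gamma (alpha + 2 + 1).
pose c0' := c0 / Gamma (alpha + 1).
have yS t : t \in `[0, 1] -> y t = c0' * t `^ alpha + sol0 alpha beta gamma F y e1 e2 t.
  move=> t01; rewrite -(RLint_langevin _ _ _ _ a0 b2 cF cy t01).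
  rewrite -[LHS]subr0 -y0 -(RD t t01); apply: eq_RLint => s.
  have := t01; rewrite !in_itv/= => /andP[t0 t1] /andP[s0 st].
  have s01 : s \in `[0, 1] by rewrite in_itv/= s0 (le_trans st).
  by rewrite -(hE s s01) /langevin (DE s s01) addrK.
have dS t : t \in `[0, 1] -> is01 (sol0 alpha beta gamma F y e1 e2) t
    (sol1 alpha beta gamma F u e1 e2 t).
  by move=> t01; exact: is01_sol0.
(* c0' s^alpha is y minus [sol0], whose derivatives at 0 are y'(0) = 0 and [sol1] at 0, which is
   0. *)
have c00 : c0' = 0.
  apply: (is01_powR_eq0 a01).
  have := is01B (dy _ zero01) (dS _ zero01).
  rewrite u0 sol1_at0// subrr; apply: eq_is01; first exact: zero01.
  by move=> s s01; rewrite (yS s s01) addrK.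
have {}yS t : t \in `[0, 1] -> y t = sol0 alpha beta gamma F y e1 e2 t.
  by move=> t01; rewrite (yS t t01) c00 mul0r add0r.
have uS t : t \in `[0, 1] -> u t = sol1 alpha beta gamma F u e1 e2 t.
  move=> t01; apply: (is01_unique t01 (dy t t01)).
  apply: eq_is01 (dS t t01) => // s s01.
  by rewrite -(yS s s01).
have [E1 E2] : e1 = d1 /\ e2 = d2.
  apply/bcoefP; split; first by rewrite -(yS _ one01).
  by rewrite -(uS _ one01).
by rewrite -E1 -E2; split.
Qed.

Lemma cont_limit (g : R -> R) :
  (forall e : R, 0 < e -> exists2 h, cont 1 h &
    forall s, s \in `[0, 1] -> `|h s - g s| <= e) -> cont 1 g.
Proof.
move=> H; apply/contP => t t01 e e0.
have e30 : 0 < e / 3 by rewrite divr_gt0.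
have [h /contP ch hg] := H _ e30.
have [d d0 dP] := ch t t01 _ e30.
exists d => // s s01 st.
have -> : g s - g t = (h s - h t) - (h s - g s) + (h t - g t) by ring.
rewrite (le_trans (ler_normD _ _))//.
have := le_trans (ler_normB (h s - h t) (h s - g s)) (lerD (dP s s01 st) (hg s s01)).
have := hg t t01; lra.
Qed.

Lemma RLint1_limit (x u : R -> R) : cont 1 u ->
  (forall e : R, 0 < e -> exists y v, [/\ cont 1 v,
    forall s, s \in `[0, 1] -> y s = RLint 1 v s,
    forall s, s \in `[0, 1] -> `|y s - x s| <= e &
    forall s, s \in `[0, 1] -> `|v s - u s| <= e]) ->
  forall s, s \in `[0, 1] -> x s = RLint 1 u s.
Proof.
move=> cu H s s01; apply/eqP; rewrite -subr_eq0 -normr_le0.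
apply/ler_addgt0Pr => e e0; rewrite add0r.
(* The 1 accounts for y - x, the other term for I^1 (v - u). *)
pose C := 1 + (Gamma (1 + 1))^-1 : R.
have G0 : 0 < Gamma (1 + 1) :> R by rewrite Gamma_gt0// addr_gt0.
have C0 : 0 < C by rewrite addr_gt0// invr_gt0.
have d0 : 0 < e / C by rewrite divr_gt0.
have [y [v [cv yv yx vu]]] := H _ d0.
have s1 : s <= 1 by move: s01; rewrite in_itv/= => /andP[].
have H1 := RLint_le1 ltr01 s01 (contB cv cu) (ltW d0) vu.
rewrite (RLintB ltr01 (contS s1 cv) (contS s1 cu)) -(yv s s01) in H1.
have -> : x s - RLint 1 u s = (y s - RLint 1 u s) - (y s - x s) by ring.
rewrite (le_trans (ler_normB _ _))// (le_trans (lerD H1 (yx s s01)))//.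
have -> : e / C / Gamma (1 + 1) + e / C = e / C * C by rewrite /C; ring.
by rewrite divfK// gt_eqF.
Qed.

Lemma sol0_at0 alpha beta gamma F x d1 d2 : 0 < alpha ->
  sol0 alpha beta gamma F x d1 d2 0 = 0.
Proof.
move=> a0; rewrite /sol0 !RLint_at0 !powR0 ?gt_eqF ?addr_gt0//.
by rewrite !mulr0 subrr !addr0.
Qed.

End FixedPoint.

(** * Existence and uniqueness *)

Theorem theorem3p2 (R : realType) (alpha beta gamma : R)
    (f : R -> R -> R -> R) (w : R) (sigma : R -> R) (a1 a2 tau1 tau2 : R)
    (psi1 : R := 14 * w / Gamma (alpha + beta + 1)
                 + 8 * `|gamma| / Gamma (alpha + 1))
    (psi2 : R := 36 * w / Gamma (alpha + beta + 1)
                 + 18 * `|gamma| / Gamma (alpha + 1))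
    (psi : R := psi1 + psi2) :
  0 < alpha <= 1 -> 2 < beta <= 3 ->
  {within [set p : R * R * R | p.1.1 \in `[0, 1]],
    continuous (fun p : R * R * R => f p.1.1 p.1.2 p.2)} ->
  0 < w ->
  (forall t x y u v : R, t \in `[0, 1] ->
    `|f t x y - f t u v| <= w * (`|x - u| + `|y - v|)) ->
  (forall t, t \in `[0, 1] -> 0 <= sigma t) ->
  lebesgue_measure.-integrable `[0, 1] (EFin \o sigma) ->
  0 <= a1 -> 0 <= a2 -> 0 < tau1 < 1 -> 0 < tau2 < 1 ->
  (forall t x y : R, t \in `[0, 1] ->
    `|f t x y| <= sigma t + a1 * `|x| `^ tau1 + a2 * `|y| `^ tau2) ->
  psi < 1 ->
  exists x : R -> R,
    is_solution alpha beta gamma f x /\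
    forall y : R -> R, is_solution alpha beta gamma f y -> {in `[0, 1], y =1 x}.
Proof.
move=> a01 b23 cf w0 lipf _ _ _ _ _ _ _ psi_lt1.
have /andP[a0 a_le1] := a01; have /andP[b2 b3] := b23.
have G0 : 0 < Gamma (alpha + beta + 1) by rewrite Gamma_gt0//; lra.
have g0 : 0 < Gamma (alpha + 1) by rewrite Gamma_gt0//; lra.
(* Both weights are strictly positive because w > 0, so distances may be divided by them. *)
have p1 : 0 < psi1.
  apply: ltr_pwDl; first exact: divr_gt0 (mulr_gt0 (ltr0n R 14) w0) G0.
  exact: divr_ge0 (mulr_ge0 (ler0n R 8) (normr_ge0 _)) (ltW g0).
have p2 : 0 < psi2.
  apply: ltr_pwDl; first exact: divr_gt0 (mulr_gt0 (ltr0n R 36) w0) G0.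
  exact: divr_ge0 (mulr_ge0 (ler0n R 18) (normr_ge0 _)) (ltW g0).
have E1 : psi1 = 14 * w / Gamma (alpha + beta + 1) + 8 * (`|gamma| / Gamma (alpha + 1)).
  by rewrite /psi1 -[8 * _ / _]mulrA.
have E2 : psi2 = 36 * w / Gamma (alpha + beta + 1) + 18 * (`|gamma| / Gamma (alpha + 1)).
  by rewrite /psi2 -[18 * _ / _]mulrA.
have psi01 : 0 <= psi < 1 by rewrite psi_lt1 andbT ltW// addr_gt0.
pose J := (bool * R)%type.
pose X (z : J -> R) s := z (false, s).
pose U (z : J -> R) s := z (true, s).
pose F (z : J -> R) s := f s (X z s) (U z s).
pose d1 z := bcoef1 alpha beta gamma (F z) (X z) (U z).
pose d2 z := bcoef2 alpha beta gamma (F z) (X z) (U z).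
pose T (z : J -> R) (j : J) : R :=
  if j.1 then sol1 alpha beta gamma (F z) (U z) (d1 z) (d2 z) j.2
  else sol0 alpha beta gamma (F z) (X z) (d1 z) (d2 z) j.2.
pose P (z : J -> R) : Prop := [/\ cont 1 (X z), cont 1 (U z) &
  forall s : R, s \in `[0, 1] -> X z s = RLint 1 (U z) s].
pose D (j : J) : Prop := j.2 \in `[0, 1].
(* A pair (x, x') is encoded as one function on bool * R, so that the weighted sup
   norm is a bound of |z j| / om j. *)
pose om (j : J) : R := if j.1 then psi2 else psi1.
have om0 j : 0 < om j by rewrite /om; case: ifP.
have cF z : P z -> cont 1 (F z) by move=> [cX cU _]; exact: cont_rhs.
have contractT z z' : P z -> P z' -> forall m : R, 0 <= m ->
    (forall j, D j -> `|z j - z' j| <= om j * m) ->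
    forall j, D j -> `|T z j - T z' j| <= om j * (psi * m).
  move=> [cX cU _] [cX' cU' _] m m0 H.
  have HX s : s \in `[0, 1] -> `|X z s - X z' s| <= psi1 * m.
    exact: (H (false, s)).
  have HU s : s \in `[0, 1] -> `|U z s - U z' s| <= psi2 * m.
    exact: (H (true, s)).
  (* With N0 = psi1 m and N1 = psi2 m, the sum N0 + N1 is exactly psi m, so each component is
     bounded by its own weight times psi m. *)
  have E : psi * m = psi1 * m + psi2 * m by rewrite mulrDl.
  case=> -[] s s01; rewrite /T/om/= E.
    rewrite {1}E2.
    exact: (sol1_contract gamma a0 a_le1 b2 b3 w0 cf lipf cX cU cX' cU' HX HU s01).
  rewrite {1}E1.
  exact: (sol0_contract gamma a0 a_le1 b2 b3 w0 cf lipf cX cU cX' cU' HX HU s01).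
have PT z : P z -> P (T z).
  move=> Pz; have [cX cU XU] := Pz; have cFz := cF z Pz.
  pose S0 := sol0 alpha beta gamma (F z) (X z) (d1 z) (d2 z).
  pose S1 := sol1 alpha beta gamma (F z) (U z) (d1 z) (d2 z).
  have cS0 : cont 1 S0 by exact: cont_sol0.
  have cS1 : cont 1 S1 by exact: cont_sol1.
  split; [exact: cS0|exact: cS1|move=> s s01].
  have dS t : t \in `[0, 1] -> is01 S0 t (S1 t) by exact: is01_sol0.
  rewrite -[LHS]/(S0 s) -[U (T z)]/S1 (RLint1_deriv cS1 dS s01).
  by rewrite [S0 0]sol0_at0// subr0.
have closedP (z_ : nat -> J -> R) (z : J -> R) : (forall n, P (z_ n)) ->
    (forall e : R, 0 < e -> exists n, forall j, D j ->
      `|z_ n j - z j| <= om j * e) -> P z.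
  move=> Pz_ H.
  (* The weights are at most max(psi1, psi2), so weighted convergence is uniform convergence of both
     components. *)
  have H' (e : R) : 0 < e -> exists n, forall j, D j -> `|z_ n j - z j| <= e.
    move=> e0; have [|n Hn] := H (e / Num.max psi1 psi2).
      by rewrite divr_gt0// lt_max p1.
    exists n => j /Hn /le_trans; apply.
    rewrite mulrA ler_pdivrMr ?lt_max ?p1// mulrC ler_wpM2l ?(ltW e0)//.
    by rewrite /om; case: ifP; rewrite le_max lexx ?orbT.
  have cU : cont 1 (U z).
    apply: cont_limit => e /H'[n Hn]; have [_ cU _] := Pz_ n.
    by exists (U (z_ n)) => // s s01; exact: (Hn (true, s)).
  split => //.
    apply: cont_limit => e /H'[n Hn]; have [cX _ _] := Pz_ n.
    by exists (X (z_ n)) => // s s01; exact: (Hn (false, s)).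
  apply: RLint1_limit => // e /H'[n Hn]; have [_ cUn XUn] := Pz_ n.
  exists (X (z_ n)), (U (z_ n)); split => // s s01.
    exact: (Hn (false, s)).
  exact: (Hn (true, s)).
(* Continuity on a compact interval makes weighted distances finite: this starts the iteration and
   the uniqueness argument. *)
have bounded z z' : P z -> P z' -> exists2 m : R, 0 <= m &
    forall j, D j -> `|z j - z' j| <= om j * m.
  move=> [cX cU _] [cX' cU' _].
  have [M M0 HM] := cont_bounded (contB cX cX').
  have [N N0 HN] := cont_bounded (contB cU cU').
  exists (M / psi1 + N / psi2); first by rewrite addr_ge0// divr_ge0// ltW.
  case=> -[] s s01; rewrite /om /= mulrDr.
    rewrite [psi2 * (N / _)]mulrC divfK ?gt_eqF// ler_wpDl; [by []| |exact: HN].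
    by rewrite mulr_ge0 ?divr_ge0// ltW.
  rewrite [psi1 * (M / _)]mulrC divfK ?gt_eqF// ler_wpDr; [by []| |exact: HM].
  by rewrite mulr_ge0 ?divr_ge0// ltW.
have P0 : P (fun=> 0).
  split; [exact: cont_cst|exact: cont_cst|move=> s].
  rewrite in_itv/= => /andP[s0 _].
  by rewrite [RHS](RLint_cst 0 ltr01 s0) mul0r.
have [m m0 Hm] := bounded _ _ (PT _ P0) P0.
have [z Pz Tz] := picard_exists psi01 contractT (fun j _ => ltW (om0 j)) PT
  closedP P0 m0 Hm.
have [cX cU XU] := Pz.
exists (X z); split.
  apply: (fixpoint_solution a01 b23 cf (u := U z)); split => // s s01.
    exact/esym/(Tz (false, s)).
  exact/esym/(Tz (true, s)).
move=> y /(solution_fixpoint a01 b23 cf)[cy cy' yy' yE y'E] s s01.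
pose z' (j : J) := if j.1 then deriv01 y j.2 else y j.2.
have Pz' : P z' by split.
have [m' m'0 Hm'] := bounded _ _ Pz' Pz.
apply: (picard_unique psi01 contractT Pz' Pz m'0 Hm' _ Tz (j := (false, s))) => //.
by case=> -[] t t01; [exact/esym/y'E|exact/esym/yE].
Qed.
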